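(* Let $R$ be a commutative Noetherian semiperfect ring, let $C$ be a semidualizing $R$-module, and let $M$ be a reduced $\mathrm{G}_C$-perfect $R$-module of $\mathrm{G}_C$-dimension $n$. Then $$\mathrm{G}_C\text{-}\dim_R(M)+\mathrm{G}_C\text{-}\dim_R(\mathrm{Tr}_C(M)) = \mathrm{G}_C\text{-}\dim_R(\mathrm{Ext}_R^n(M,C))+1,$$ as an equality in $\mathbb{N}\cup\{\infty\}$.
   Context: A commutative Noetherian ring is semiperfect iff it is a finite direct product of local rings. ''Finite'' module means finitely generated. A finite $R$-module $C$ is semidualizing if the homothety map $R\to\mathrm{Hom}_R(C,C)$ is an isomorphism and $\mathrm{Ext}^i_R(C,C)=0$ for all $i>0$. Write $(-)^C=\mathrm{Hom}_R(-,C)$. A finite module $X$ is totally $C$-reflexive if the biduality map $X\to X^{CC}$ is an isomorphism and $\mathrm{Ext}^i_R(X,C)=\mathrm{Ext}^i_R(X^C,C)=0$ for all $i>0$. For a finite module $M$, $\mathrm{G}_C\text{-}\dim_R(M)$ is the smallest $n\ge 0$ such that there is an exact sequence $0\to X_n\to\cdots\to X_0\to M\to 0$ with all $X_i$ totally $C$-reflexive, and $\infty$ if no such $n$ exists. $\mathrm{r.grade}_R(M,C)=\inf\{i>0\mid \mathrm{Ext}^i_R(M,C)\ne 0\}$ (with $\inf\emptyset=\infty$). A finite module $M$ with finite $\mathrm{G}_C$-dimension is reduced $\mathrm{G}_C$-perfect if $\mathrm{r.grade}_R(M,C)=\mathrm{G}_C\text{-}\dim_R(M)$ (so its $\mathrm{G}_C$-dimension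 is automatically positive). If $P_1\xrightarrow{f}P_0\to M\to 0$ is a presentation by finite projective modules, $\mathrm{Tr}_C(M)=\mathrm{Coker}(f^C\colon P_0^C\to P_1^C)$; it is unique up to adding direct summands of finite direct sums of copies of $C$, and its $\mathrm{G}_C$-dimension does not depend on the choice. *)

(* Defs.v *)
From HB Require Import structures.
From mathcomp Require Import all_boot all_order all_algebra.
From mathcomp Require Import boolp classical_sets functions constructive_ereal.
From mathcomp.multinomials Require Import freeg.

Set Implicit Arguments.
Unset Strict Implicit.
Unset Printing Implicit Defensive.

Import GRing.Theory.
Local Open Scope classical_set_scope.
Local Open Scope ring_scope.
Local Open Scope quotient_scope.

(** * The module Hom_R(U, V) *)

Section Hom.
Variables (R : comNzRingType) (U V : lmodType R).
Implicit Types f g h : {linear U -> V}.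

HB.instance Definition _ := gen_eqMixin {linear U -> V}.
HB.instance Definition _ := gen_choiceMixin {linear U -> V}.

Lemma linear_ext f g : f =1 g -> f = g.
Proof.
case: f g => [f cf] [g cg] /= /funext /= e.
case: _ / e in cg *; congr GRing.Linear.Pack.
case: cf cg => [[?] [?]] [[?] [?]]; congr GRing.Linear.Class; f_equal;
  exact: Prop_irrelevance.
Qed.

Definition hom_zero : {linear U -> V} := \0.
Definition hom_opp f : {linear U -> V} := \- f.
Definition hom_add f g : {linear U -> V} := f \+ g.
Definition hom_scale (a : R) f : {linear U -> V} := a \*: f.

Lemma hom_addA : associative hom_add.
Proof. by move=> f g h; apply: linear_ext => x /=; rewrite addrA. Qed.
Lemma hom_addC : commutative hom_add.
Proof. by move=> f g; apply: linear_ext => x /=; rewrite addrC. Qed.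
Lemma hom_add0 : left_id hom_zero hom_add.
Proof. by move=> f; apply: linear_ext => x /=; rewrite add0r. Qed.
Lemma hom_addN : left_inverse hom_zero hom_opp hom_add.
Proof. by move=> f; apply: linear_ext => x /=; rewrite addNr. Qed.
HB.instance Definition _ :=
  GRing.isZmodule.Build {linear U -> V} hom_addA hom_addC hom_add0 hom_addN.

Lemma hom_scaleA a b f : hom_scale a (hom_scale b f) = hom_scale (a * b) f.
Proof. by apply: linear_ext => x /=; rewrite scalerA. Qed.
Lemma hom_scale1 : left_id 1 hom_scale.
Proof. by move=> f; apply: linear_ext => x /=; rewrite scale1r. Qed.
Lemma hom_scaleDr : right_distributive hom_scale +%R.
Proof. by move=> a f g; apply: linear_ext => x /=; rewrite scalerDr. Qed.
Lemma hom_scaleDl f : {morph hom_scale^~ f : a b / a + b}.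
Proof. by move=> a b; apply: linear_ext => x /=; rewrite scalerDl. Qed.
HB.instance Definition _ := GRing.Zmodule_isLmodule.Build R {linear U -> V}
  hom_scaleA hom_scale1 hom_scaleDr hom_scaleDl.

Definition hom : lmodType R := {linear U -> V}.
End Hom.

Section HomMaps.
Variable R : comNzRingType.
Implicit Types U V N C X : lmodType R.

Section Precomp.
Variables (U V : lmodType R) (f : {linear U -> V}) (N : lmodType R).
Definition precomp_fun (g : {linear V -> N}) : {linear U -> N} := g \o f.
Lemma precomp_linear : linear precomp_fun.
Proof. by move=> a g h; apply: linear_ext. Qed.
HB.instance Definition _ :=
  GRing.isLinear.Build R (hom V N) (hom U N) *:%R precomp_fun precomp_linear.
Definition precomp : {linear hom V N -> hom U N} := precomp_fun.
End Precomp.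

Section Biduality.
Variables (C X : lmodType R).
Definition biduality_at (x : X) (f : {linear X -> C}) : C := f x.
Lemma biduality_at_linear x : linear (biduality_at x).
Proof. by []. Qed.
HB.instance Definition _ x :=
  GRing.isLinear.Build R (hom X C) C *:%R (biduality_at x)
    (biduality_at_linear x).
Definition biduality_fun (x : X) : {linear hom X C -> C} := biduality_at x.
Lemma biduality_linear : linear biduality_fun.
Proof.
by move=> a x y; apply: linear_ext => f /=; rewrite /biduality_at linearP.
Qed.
HB.instance Definition _ :=
  GRing.isLinear.Build R X (hom (hom X C) C) *:%R biduality_fun
    biduality_linear.
Definition biduality : {linear X -> hom (hom X C) C} := biduality_fun.
End Biduality.

Section Homothety.
Variable C : lmodType R.
Definition homothety_fun (a : R^o) : {linear C -> C} := a \*: idfun.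
Lemma homothety_linear : linear homothety_fun.
Proof.
by move=> a b c; apply: linear_ext => x /=; rewrite scalerDl scalerA.
Qed.
HB.instance Definition _ :=
  GRing.isLinear.Build R R^o (hom C C) *:%R homothety_fun homothety_linear.
Definition homothety : {linear R^o -> hom C C} := homothety_fun.
End Homothety.
End HomMaps.

(** * Kernels, quotients, cokernels and homology *)

Section Kernel.
Variables (R : comNzRingType) (U V : lmodType R) (f : {linear U -> V}).

Definition in_ker : {pred U} := [pred x | f x == 0].
Lemma in_ker_closed : submod_closed in_ker.
Proof.
split=> [|a x y]; rewrite !inE ?linear0 // => /eqP fx /eqP fy.
by rewrite linearP fx fy scaler0 addr0.
Qed.
HB.instance Definition _ := GRing.isSubmodClosed.Build R U in_ker in_ker_closed.

Record ker_type := Ker { ker_val :> U; ker_valP : ker_val \in in_ker }.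
HB.instance Definition _ := [isSub for ker_val].
HB.instance Definition _ := [Choice of ker_type by <:].
HB.instance Definition _ := [SubChoice_isSubLmodule of ker_type by <:].

Definition ker_mod : lmodType R := ker_type.
Definition ker_incl : {linear ker_mod -> U} := (val : ker_type -> U).
End Kernel.

Record submodule (R : comNzRingType) (V : lmodType R) := Submodule {
  submod_pred :> {pred V};
  submod_predP : submod_closed submod_pred }.
HB.instance Definition _ (R : comNzRingType) (V : lmodType R)
    (S : submodule V) :=
  GRing.isSubmodClosed.Build R V (submod_pred S) (submod_predP S).

Section QuotientModule.
Variables (R : comNzRingType) (V : lmodType R) (S : submodule V).

Definition quot_type := Quotient.quot (submod_pred S).
HB.instance Definition _ := GRing.Zmodule.on quot_type.
HB.instance Definition _ := EqQuotient.on quot_type.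

Definition quot_scale (a : R) : quot_type -> quot_type :=
  lift_op1 quot_type ( *:%R a).
Lemma pi_quot_scale a : {morph \pi_quot_type : x / a *: x >-> quot_scale a x}.
Proof.
move=> x; unlock quot_scale; apply/eqP; rewrite piE /Quotient.equiv -scalerBr.
by rewrite rpredZ // Quotient.idealrBE reprK.
Qed.
Canonical pi_quot_scale_morph a := PiMorph1 (pi_quot_scale a).

Lemma quot_scaleA a b x : quot_scale a (quot_scale b x) = quot_scale (a * b) x.
Proof. by rewrite -[x]reprK !piE scalerA. Qed.
Lemma quot_scale1 : left_id 1 quot_scale.
Proof. by move=> x; rewrite -[x]reprK !piE scale1r. Qed.
Lemma quot_scaleDr : right_distributive quot_scale +%R.
Proof.
by move=> a x y; rewrite -[x]reprK -[y]reprK -!pi_quot_scale -!raddfD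
  -pi_quot_scale scalerDr raddfD.
Qed.
Lemma quot_scaleDl x : {morph quot_scale^~ x : a b / a + b}.
Proof.
by move=> a b; rewrite -[x]reprK -!pi_quot_scale -raddfD -scalerDl.
Qed.
HB.instance Definition _ := GRing.Zmodule_isLmodule.Build R quot_type
  quot_scaleA quot_scale1 quot_scaleDr quot_scaleDl.

Definition quot_mod : lmodType R := quot_type.
Lemma quot_pi_eq0 x : (\pi_quot_type x == 0) = (x \in submod_pred S).
Proof.
by rewrite -[x in RHS]subr0 Quotient.idealrBE [X in _ = (_ == X)]raddf0.
Qed.
End QuotientModule.

Section Homology.
Variables (R : comNzRingType) (U V W : lmodType R).

Definition in_im (f : {linear U -> V}) : {pred V} :=
  [pred y | `[< exists x, f x = y >]].
Lemma in_im_closed f : submod_closed (in_im f).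
Proof.
split=> [|a _ _ /asboolP[x <-] /asboolP[y <-]]; apply/asboolP.
  by exists 0; rewrite linear0.
by exists (a *: x + y); rewrite linearP.
Qed.
Definition im_mod f : submodule V := Submodule (in_im_closed f).

Definition coker f : lmodType R := quot_mod (im_mod f).

Definition in_preim (f : {linear U -> V}) (S : submodule V) : {pred U} :=
  [pred x | f x \in S].
Lemma in_preim_closed f S : submod_closed (in_preim f S).
Proof.
have [S0 Slin] := submod_predP S.
split=> [|a x y]; rewrite !inE ?linear0 // linearP; exact: Slin.
Qed.
Definition preim_mod f S : submodule U := Submodule (in_preim_closed f S).
End Homology.

(* Ker g / (Im f \cap Ker g), that is, Ker g / Im f when g \o f = 0. *)
Definition homology (R : comNzRingType) (U V W : lmodType R)
    (f : {linear U -> V}) (g : {linear V -> W}) : lmodType R :=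
  quot_mod (preim_mod (ker_incl g) (im_mod f)).

(** * Resolutions and Ext *)

Definition exact_at (R : comNzRingType) (U V W : lmodType R)
    (f : {linear U -> V}) (g : {linear V -> W}) :=
  forall y, g y = 0 <-> exists x, f x = y.

Definition onto (R : comNzRingType) (U V : lmodType R) (f : {linear U -> V}) :=
  forall y, exists x, f x = y.

(* ... -> X 2 -> X 1 -> X 0 -> M -> 0 *)
Record resolution (R : comNzRingType) (M : lmodType R) := Resolution {
  res_obj :> nat -> lmodType R;
  res_d : forall i, {linear res_obj i.+1 -> res_obj i};
  res_aug : {linear res_obj 0%N -> M};
  res_aug_onto : onto res_aug;
  res_exact0 : exact_at (res_d 0%N) res_aug;
  res_exactS : forall i, exact_at (res_d i.+1) (res_d i) }.

Definition projective (R : comNzRingType) (P : lmodType R) :=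
  forall (U V : lmodType R) (g : {linear U -> V}) (f : {linear P -> V}),
    onto g -> exists h : {linear P -> U}, forall x, g (h x) = f x.

Section FgliftLinear.
Variables (R : comNzRingType) (K : choiceType) (M : lmodType R) (f : K -> M).
Lemma fglift_linear : linear (fglift f : {freeg K / R} -> M).
Proof.
have fgliftB := lift_is_additive f.
have fglift0 : fglift f (0 : {freeg K / R}) = 0.
  by rewrite -[X in fglift _ X](subrr 0) fgliftB subrr.
have fgliftD (D E : {freeg K / R}) : fglift f (D + E) = fglift f D + fglift f E.
  by rewrite -[E in LHS]opprK fgliftB -[- E]sub0r fgliftB fglift0 sub0r opprK.
have fglift_sum (s : seq K) (F : K -> {freeg K / R}) :
    fglift f (\sum_(x <- s) F x) = \sum_(x <- s) fglift f (F x).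
  by elim/big_rec2: _ => [|x y1 y2 _ <-].
move=> a D E; rewrite fgliftD; congr (_ + _).
rewrite -[D in RHS]freeg_sumE [LHS]fglift_sum fglift_sum scaler_sumr.
by apply: eq_bigr => x _; rewrite !liftU scalerA.
Qed.
HB.instance Definition _ :=
  GRing.isLinear.Build R {freeg K / R} M *:%R (fglift f) fglift_linear.
End FgliftLinear.

(* The canonical free resolution of M: X 0 is the free module on the set M,
   X 1 the free module on the set Ker(X 0 -> M), and so on. *)
Section FreeResolution.
Variable R : comNzRingType.
Implicit Types M : lmodType R.

Definition free_on M : lmodType R := {freeg M / R}.
Definition free_cover M : {linear free_on M -> M} := fglift id.

Lemma free_on_projective M : projective (free_on M).
Proof.
move=> U V g f g_onto.
have [s sK] := boolp.choice g_onto.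
exists (fglift (fun x => s (f << x >>)) : {linear free_on M -> U}) => D.
rewrite -[D]freeg_sumE !linear_sum; apply: eq_bigr => x _.
rewrite [X in g X]liftU linearZ sK -linearZ; congr (f _).
by apply/eqP/freeg_eqP => y; rewrite coeffZ !coeffU mul1r.
Qed.

Definition syzygy M : lmodType R := ker_mod (free_cover M).

Variable M : lmodType R.
Definition free_res_obj i : lmodType R := free_on (iter i syzygy M).
Definition free_res_d i : {linear free_res_obj i.+1 -> free_res_obj i} :=
  ker_incl (free_cover (iter i syzygy M)) \o free_cover (iter i.+1 syzygy M).

Lemma free_cover_onto N : onto (free_cover N).
Proof. by move=> x; exists << x >>; rewrite [LHS]liftU scale1r. Qed.

Lemma syzygy_exact (N U : lmodType R) (g : {linear N -> U}) :
  injective g ->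
  exact_at (ker_incl (free_cover N) \o free_cover (syzygy N)) (g \o free_cover N).
Proof.
move=> g_inj y; split=> [gy0|[x <-]].
  have y0 : y \in in_ker (free_cover N).
    by rewrite inE; apply/eqP/g_inj; rewrite linear0.
  by have [x xE] := free_cover_onto (Ker y0 : syzygy N); exists x; rewrite /= xE.
have /eqP /= -> := ker_valP (free_cover (syzygy N) x).
by rewrite linear0.
Qed.

Lemma free_res_exact0 : exact_at (free_res_d 0%N) (free_cover M).
Proof. exact: (@syzygy_exact M M idfun (fun _ _ e => e)). Qed.

Lemma free_res_exactS i : exact_at (free_res_d i.+1) (free_res_d i).
Proof. exact/syzygy_exact/val_inj. Qed.

Definition free_resolution : resolution M :=
  Resolution (@free_cover_onto M) free_res_exact0 free_res_exactS.
End FreeResolution.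

(* The cohomology of 0 -> Hom(P 0, N) -> Hom(P 1, N) -> ... in degree i. *)
Definition hom_cohomology (R : comNzRingType) (M : lmodType R)
    (P : resolution M) (N : lmodType R) (i : nat) : lmodType R :=
  if i is j.+1 then homology (precomp (res_d P j) N) (precomp (res_d P j.+1) N)
  else homology (\0 : {linear hom (P 0%N) N -> hom (P 0%N) N})
         (precomp (res_d P 0%N) N).

Definition Ext (R : comNzRingType) (i : nat) (M N : lmodType R) : lmodType R :=
  hom_cohomology (free_resolution M) N i.

Definition zero_module (R : comNzRingType) (M : lmodType R) :=
  forall x : M, x = 0.

(** * Finiteness and ring-theoretic conditions *)

Definition finite_module (R : comNzRingType) (M : lmodType R) :=
  exists (n : nat) (e : 'I_n -> M),
    forall x, exists c : 'I_n -> R, x = \sum_(i < n) c i *: e i.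

Definition ideal (R : comNzRingType) (I : set R) :=
  [/\ I 0, forall x y, I x -> I y -> I (x + y)
    & forall a x, I x -> I (a * x)].

Definition noetherian (R : comNzRingType) :=
  forall I : set R, ideal I -> exists (n : nat) (e : 'I_n -> R),
    I = [set x | exists c : 'I_n -> R, x = \sum_(i < n) c i * e i].

Definition maximal_ideal (R : comNzRingType) (I : set R) :=
  [/\ ideal I, ~ I 1
    & forall J : set R, ideal J -> ~ J 1 -> I `<=` J -> J = I].

Definition local_ring (R : comNzRingType) := exists! I : set R, maximal_ideal I.

(* R is a finite direct product of local rings; for commutative Noetherian
   rings this is what semiperfect means. *)
Definition semiperfect (R : comNzRingType) :=
  exists (n : nat) (S : 'I_n -> comNzRingType)
      (p : forall i, {rmorphism R -> S i}),
    (forall i, local_ring (S i)) /\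
    bijective (fun (x : R) (i : 'I_n) => p i x : S i).

(** * Gorenstein dimension with respect to C *)

(* The infimum in N U {oo}; \bar nat also has an element -oo, which is never
   a value here. *)
Definition inf_nat (A : set nat) : \bar nat :=
  if pselect (exists n, `[< A n >]) is left exA then ((ex_minn exA)%:E)%E
  else +oo%E.

Section GorensteinDimension.
Variables (R : comNzRingType) (C : lmodType R).
Implicit Types M X : lmodType R.

Definition semidualizing :=
  [/\ finite_module C, bijective (homothety C)
    & forall i, (0 < i)%N -> zero_module (Ext i C C)].

Definition totally_reflexive X :=
  [/\ finite_module X, bijective (biduality C X),
      forall i, (0 < i)%N -> zero_module (Ext i X C)
    & forall i, (0 < i)%N -> zero_module (Ext i (hom X C) C)].

(* Exact sequences 0 -> X n -> ... -> X 0 -> M -> 0 are the resolutions of M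
   that vanish beyond n. *)
Definition has_gdim_le M (n : nat) :=
  exists X : resolution M,
    (forall i, (i <= n)%N -> totally_reflexive (X i)) /\
    (forall i, (n < i)%N -> zero_module (X i)).

Definition gdim M : \bar nat := inf_nat [set n | has_gdim_le M n].

Definition rgrade M : \bar nat :=
  inf_nat [set i | (0 < i)%N /\ ~ zero_module (Ext i M C)].

Definition reduced_gperfect M :=
  [/\ finite_module M, gdim M <> +oo%E & rgrade M = gdim M].

(* P1 -f-> P0 -p-> M -> 0 *)
Definition projective_presentation M (P1 P0 : lmodType R)
    (f : {linear P1 -> P0}) (p : {linear P0 -> M}) :=
  [/\ finite_module P1 /\ projective P1, finite_module P0 /\ projective P0,
      exact_at f p & onto p].

(* Tr_C(Coker f) computed from the presentation f *)
Definition auslander_transpose (P1 P0 : lmodType R) (f : {linear P1 -> P0}) :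
    lmodType R :=
  coker (precomp f C).
End GorensteinDimension.

(* Main.v *)
(* Since Ext^i(M, C) = 0 for 0 < i < n, dualizing a projective resolution P of M
   gives an exact sequence
   0 -> Tr_C M -> P_2^C -> ... -> P_(n-1)^C -> (Omega^n M)^C -> Ext^n(M, C) -> 0
   when n >= 2, and 0 -> Ext^1(M, C) -> Tr_C M -> (Omega^2 M)^C -> 0 when n = 1.
   As Omega^n M is totally C-reflexive, in both cases G_C-dim Tr_C M <= d iff
   G_C-dim Ext^n(M, C) <= d + n - 1, for every d >= 0.  It remains to exclude
   G_C-dim Ext^n(M, C) < n - 1: then Tr_C M would be totally C-reflexive, and so
   would be M = M^CC, contradicting Ext^n(M, C) <> 0. *)
From HB Require Import structures.
From mathcomp Require Import all_boot all_order all_algebra.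
From mathcomp Require Import boolp classical_sets functions constructive_ereal.
Require Import Defs.

Set Implicit Arguments.
Unset Strict Implicit.
Unset Printing Implicit Defensive.

Import GRing.Theory.
Local Open Scope ring_scope.
Local Open Scope quotient_scope.

(** The obstacle is that [Ext] is fixed by the canonical free resolution, whose terms are huge,
    while the transpose comes from an arbitrary finite presentation. The two are compared in the
    stable category, where maps that factor through a projective count as zero and syzygies no
    longer depend on the chosen cover. No long exact sequence of Ext is built. Vanishing of Ext^1 is
    an extension property, higher degrees are reached by taking syzygies, and exactness arguments
    become pullbacks and rotations of short exact sequences. The G_C-dimension is likewise not read
    off from Ext. Everything rests on one fact: if T is totally C-reflexive and 0 -> A -> B -> T ->
    0 is exact, then A and B satisfy the same bounds. For n = 1 it applies directly to the
    transpose. For larger n, M is replaced by its first syzygy, because Tr_C M is itself a syzygy of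
    Tr_C (Omega M); each such step trades one unit of n for one unit of d. *)

Section LinearMaps.
Variable R : comNzRingType.
Implicit Types U V W A B M N K P : lmodType R.

(** Packs a linearity proof locally, so that maps can be produced inside proofs and known only
    through their values. *)
Lemma ex_linear U V (f : U -> V) :
  linear f -> exists g : {linear U -> V}, g =1 f.
Proof.
move=> lf; pose m := GRing.isLinear.Build R U V *:%R f lf.
by exists (HB.pack_for {linear U -> V} f m).
Qed.

Definition injective0 U V (f : {linear U -> V}) := forall x, f x = 0 -> x = 0.

Lemma injI U V (f : {linear U -> V}) : injective0 f -> injective f.
Proof.
by move=> fi x y e; apply/eqP; rewrite -subr_eq0 (fi (x - y)) // linearB /= e subrr.
Qed.

Lemma bijective_of U V (f : {linear U -> V}) : injective0 f -> onto f -> bijective f.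
Proof.
move=> /injI fi /boolp.choice[g gK]; exists g => x; first by apply: fi; rewrite gK.
exact: gK.
Qed.

Lemma bijective_inj U V (f : {linear U -> V}) : bijective f -> injective0 f.
Proof. by move=> /bij_inj fi x fx; apply: fi; rewrite fx linear0. Qed.

Lemma bijective_onto U V (f : {linear U -> V}) : bijective f -> onto f.
Proof. by case=> g _ gK y; exists (g y). Qed.

(** Preimages are picked by choice; injectivity of [i] makes them unique, which forces the choice to
    be linear. *)
Lemma factor_inj A B V (i : {linear A -> B}) (f : {linear V -> B}) :
  injective0 i -> (forall x, exists a, i a = f x) ->
  exists g : {linear V -> A}, forall x, i (g x) = f x.
Proof.
move=> /injI ii /boolp.choice[g gE].
have [|h hE] := @ex_linear _ _ g; last by exists h => x; rewrite hE gE.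
by move=> a x y; apply: ii; rewrite linearP !gE linearP.
Qed.

Lemma factor_onto B M N (q : {linear B -> M}) (f : {linear B -> N}) :
  onto q -> (forall x, q x = 0 -> f x = 0) ->
  exists g : {linear M -> N}, forall x, g (q x) = f x.
Proof.
move=> /boolp.choice[s sK] fq.
have fqE x y : q x = q y -> f x = f y.
  move=> e; apply/eqP; rewrite -subr_eq0 -linearB fq //.
  by rewrite linearB e subrr.
have [|g gE] := @ex_linear _ _ (fun y => f (s y)).
  by move=> a x y; rewrite -linearP; apply: fqE; rewrite linearP !sK.
by exists g => x; rewrite gE; apply: fqE; rewrite sK.
Qed.

(** Below, quotients are accessed only through such a projection, never through their
    representatives. *)
Lemma quot_projP V (S : submodule V) :
  exists p : {linear V -> quot_mod S},
    onto p /\ forall x, p x = 0 <-> x \in submod_pred S.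
Proof.
pose Q := quot_type S.
have [|p pE] := @ex_linear V (quot_mod S) (fun x => \pi_Q x).
  move=> a x y; rewrite raddfD /=; congr (_ + _); exact: (pi_quot_scale S a x).
exists p; split=> [y|x]; first by exists (repr y); rewrite pE reprK.
by rewrite pE -quot_pi_eq0; split=> [->|/eqP].
Qed.

Lemma cokerP U V (f : {linear U -> V}) :
  exists p : {linear V -> coker f}, onto p /\ exact_at f p.
Proof.
have [p [p_onto pE]] := quot_projP (im_mod f).
by exists p; split=> // y; rewrite pE; split=> /asboolP.
Qed.

Lemma ker_val0 U V (f : {linear U -> V}) (k : ker_mod f) : f (ker_incl f k) = 0.
Proof. by have /eqP := ker_valP k. Qed.

Lemma ker_incl_inj U V (f : {linear U -> V}) : injective0 (ker_incl f).
Proof. by move=> x x0; apply: val_inj; apply: x0. Qed.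

Lemma ker_inclP U V (f : {linear U -> V}) x :
  f x = 0 -> exists k, ker_incl f k = x.
Proof. by move=> /eqP fx; exists (@Ker _ _ _ f x fx). Qed.
End LinearMaps.

(** * Short exact sequences, pullbacks and rotation *)

Definition ses (R : comNzRingType) (A B M : lmodType R)
    (i : {linear A -> B}) (q : {linear B -> M}) :=
  [/\ injective0 i, exact_at i q & onto q].

Section ShortExact.
Variable R : comNzRingType.
Implicit Types U V W A B M N K P : lmodType R.

Lemma ses_ker B M (q : {linear B -> M}) : onto q -> ses (ker_incl q) q.
Proof.
move=> qo; split=> //; first exact: ker_incl_inj.
by move=> y; split=> [/ker_inclP//|[k <-]]; rewrite ker_val0.
Qed.

Lemma ses_comp0 A B M (i : {linear A -> B}) (q : {linear B -> M}) a :
  ses i q -> q (i a) = 0.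
Proof. by case=> _ e _; apply/e; exists a. Qed.

Lemma ex_fst U V : exists f : {linear (U * V)%type -> U}, forall x, f x = x.1.
Proof. exact: (@ex_linear _ _ _ (fun x : U * V => x.1)). Qed.

Lemma ex_snd U V : exists f : {linear (U * V)%type -> V}, forall x, f x = x.2.
Proof. exact: (@ex_linear _ _ _ (fun x : U * V => x.2)). Qed.

Lemma ex_pair U V W (f : {linear W -> U}) (g : {linear W -> V}) :
  exists h : {linear W -> (U * V)%type}, forall x, h x = (f x, g x).
Proof.
apply: (@ex_linear _ _ (U * V)%type (fun x => (f x, g x))) => a x y.
by rewrite !linearP.
Qed.

Lemma ex_copair U V W (f : {linear U -> W}) (g : {linear V -> W}) :
  exists h : {linear (U * V)%type -> W}, forall x y, h (x, y) = f x + g y.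
Proof.
have [|h hE] := @ex_linear _ (U * V)%type W (fun z => f z.1 + g z.2).
  by move=> a x y; rewrite /= !linearP scalerDr addrACA.
by exists h => x y; rewrite hE.
Qed.

(* Y is the pullback of B and V over M; the last two conjuncts are its
   universal property. *)
Lemma ses_pullback A B M V (i : {linear A -> B}) (q : {linear B -> M})
    (v : {linear V -> M}) : ses i q ->
  exists (Y : lmodType R) (j : {linear A -> Y}) (r : {linear Y -> V})
    (b : {linear Y -> B}),
  [/\ ses j r, forall a, b (j a) = i a, forall y, q (b y) = v (r y)
   & (forall x z, q x = v z -> exists y, b y = x /\ r y = z) /\
     (forall y, b y = 0 -> r y = 0 -> y = 0)].
Proof.
move=> iq; have [ii ex qo] := iq.
have [d dE] := ex_copair q (- v : {linear V -> M}).
have [pb pbE] := ex_fst B V; have [pr prE] := ex_snd B V.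
have [h hE] := ex_pair i (\0 : {linear A -> V}).
have [a|j jE] := factor_inj (f := h) (@ker_incl_inj _ _ _ d).
  by apply: ker_inclP; rewrite hE dE (ses_comp0 _ iq) linear0 addr0.
have dk k : q (ker_incl d k).1 = v (ker_incl d k).2.
  have := ker_val0 k; case: (ker_incl d k) => x z; rewrite dE => /eqP.
  by rewrite subr_eq0 => /eqP.
have lift x z : q x = v z -> exists k, ker_incl d k = (x, z).
  by move=> e; apply: ker_inclP; rewrite dE e subrr.
have [b bE] : exists b : {linear ker_mod d -> B},
    forall y, b y = (ker_incl d y).1.
  by exists (pb \o ker_incl d) => y; apply: pbE.
have [r rE] : exists r : {linear ker_mod d -> V},
    forall y, r y = (ker_incl d y).2.
  by exists (pr \o ker_incl d) => y; apply: prE.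
exists (ker_mod d), j, r, b.
split; last split.
- split=> [a|y|z].
  + move=> ja; apply: ii; have: h a = 0 by rewrite -jE ja linear0.
    by rewrite hE => -[].
  + rewrite rE; split=> [y0|[a <-]]; last by rewrite jE hE.
    have /ex[a aE]: q (ker_incl d y).1 = 0 by rewrite dk y0 linear0.
    exists a; apply: (injI (@ker_incl_inj _ _ _ d)).
    by rewrite jE hE aE [RHS]surjective_pairing y0.
  + have [x xE] := qo (v z); have [k kE] := lift _ _ xE.
    by exists k; rewrite rE kE.
- by move=> a; rewrite bE jE hE.
- by move=> y; rewrite bE rE dk.
- by move=> x z /lift[k kE]; exists k; rewrite bE rE kE.
- move=> y; rewrite bE rE => e1 e2; apply: (@ker_incl_inj _ _ _ d).
  by rewrite [LHS]surjective_pairing e1 e2.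
Qed.

(** The pullback of two surjections onto the same module lies in two short exact sequences at once,
    as in Schanuel's lemma; this is how two covers of M are compared. *)
Lemma ses_pullback2 A B A' B' M (i : {linear A -> B}) (q : {linear B -> M})
    (i' : {linear A' -> B'}) (q' : {linear B' -> M}) : ses i q -> ses i' q' ->
  exists (Y : lmodType R) (j : {linear A -> Y}) (r : {linear Y -> B'})
    (j' : {linear A' -> Y}) (b : {linear Y -> B}),
  [/\ ses j r, ses j' b, forall x, b (j x) = i x & forall x, r (j' x) = i' x].
Proof.
move=> iq iq'; have [Y [j [r [b [jr jE bE [ex_b b_inj]]]]]] := ses_pullback q' iq.
have [d dE] := ex_pair b r; have [z zE] := ex_pair (\0 : {linear A' -> B}) i'.
have d_inj : injective0 d by move=> y; rewrite dE => -[/b_inj]; apply.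
have [x|j' j'E] := factor_inj (f := z) d_inj.
  have [|y [y1 y2]] := ex_b 0 (i' x).
    by rewrite linear0 (ses_comp0 _ iq').
  by exists y; rewrite dE zE y1 y2.
have [bj rj] : (forall x, b (j' x) = 0) /\ (forall x, r (j' x) = i' x).
  by split=> x; have := j'E x; rewrite dE zE => -[].
have [ii' ix' qo'] := iq'.
exists Y, j, r, j', b; split=> //; split=> [x x0|y|x].
- by apply: ii'; rewrite -rj x0 linear0.
- split=> [y0|[x <-]]; last exact: bj.
  have /ix'[x xE] : q' (r y) = 0 by rewrite -bE y0 linear0.
  by exists x; apply: (injI d_inj); rewrite !dE bj rj y0 xE.
- by have [x' x'E] := qo' (q x); have [y [<- _]] := ex_b _ _ (esym x'E); exists y.
Qed.

Lemma lift_proj P M B (q : {linear B -> M}) (f : {linear P -> M}) :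
  projective P -> onto q -> exists h : {linear P -> B}, forall x, q (h x) = f x.
Proof. by move=> + qo; apply. Qed.

(** The pullback of [q] and [p] splits over the projective P as A x P, and its projection to B has
    kernel K. The sign in [j] makes the composite [r \o j] vanish. *)
Lemma ses_rotate A B M P K (i : {linear A -> B}) (q : {linear B -> M})
    (k : {linear K -> P}) (p : {linear P -> M}) :
  projective P -> ses i q -> ses k p ->
  exists (psi : {linear K -> A}) (phi : {linear P -> B})
    (j : {linear K -> (A * P)%type}) (r : {linear (A * P)%type -> B}),
  [/\ ses j r, forall x, j x = (- psi x, k x), forall a x, r (a, x) = i a + phi x,
    forall x, i (psi x) = phi (k x) & forall x, q (phi x) = p x].
Proof.
move=> prP iq kp; have [ii ex qo] := iq; have [ki kex ko] := kp.
have [phi phiE] := prP _ _ _ p qo.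
have [psi psiE] : exists psi : {linear K -> A}, forall x, i (psi x) = (phi \o k) x.
  apply: factor_inj => // x; apply/ex; rewrite phiE.
  exact: (ses_comp0 _ kp).
have [j jE] := ex_pair (- psi : {linear K -> A}) k.
have [r rE] := ex_copair i phi.
exists psi, phi, j, r; split=> //; split.
- by move=> x; rewrite jE => -[_ /ki].
- case=> a x; rewrite rE; split=> [e|[y]]; last first.
    by rewrite jE => -[<- <-]; rewrite linearN psiE addNr.
  have /kex[y yE]: p x = 0.
    by have := congr1 q e; rewrite linearD /= (ses_comp0 _ iq) add0r phiE linear0.
  exists y; suff <- : - psi y = a by rewrite jE yE.
  apply: (injI ii); apply/eqP; rewrite linearN psiE /= yE.
  by rewrite eqr_oppLR -addr_eq0 addrC e.
- move=> b; have [x xE] := ko (q b).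
  have /ex[a aE]: q (b - phi x) = 0 by rewrite linearB /= phiE xE subrr.
  by exists (a, x); rewrite rE aE subrK.
Qed.

Lemma ses_dual (C : lmodType R) A B M (i : {linear A -> B}) (q : {linear B -> M}) :
  exact_at i q -> onto q ->
  injective0 (precomp q C) /\ exact_at (precomp q C) (precomp i C).
Proof.
move=> ex qo; split=> [g g0|g].
  apply: linear_ext => y; have [x <-] := qo y.
  by rewrite -[g (q x)]/((precomp q C g : {linear _ -> _}) x) g0.
split=> [g0|[h <-]].
  have [|h hE] := factor_onto qo (f := g).
    move=> x /ex[a <-].
    by rewrite -[g (i a)]/((precomp i C g : {linear _ -> _}) a) g0.
  by exists h; apply: linear_ext.
apply: linear_ext => a /=.
have -> : q (i a) = 0 by apply/ex; exists a.
by rewrite linear0.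
Qed.
End ShortExact.

(** * Stable equivalence of modules and the vanishing of Ext *)

Section StableEquivalence.
Variable R : comNzRingType.
Implicit Types A B C K L M N P Q U V W X : lmodType R.

Lemma ses_free M : ses (ker_incl (free_cover M)) (free_cover M).
Proof. exact/ses_ker/free_cover_onto. Qed.

(* Vanishing of Ext^1(M, C), read off extensions by M instead of a resolution. *)
Definition ext1_zero C M := forall A B (i : {linear A -> B}) (q : {linear B -> M}),
  ses i q -> forall g : {linear A -> C},
  exists h : {linear B -> C}, forall a, h (i a) = g a.

Lemma ext1_zero_proj C P : projective P -> ext1_zero C P.
Proof.
move=> prP A B i q [ii ix qo] g; have [s sE] := prP _ _ q idfun qo.
have [x|r rE] := factor_inj (f := idfun \- (s \o q)) ii.
  by apply/ix; rewrite linearB /= sE subrr.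
exists (g \o r) => a; congr (g _); apply: (injI ii).
have qia : q (i a) = 0 by apply/ix; exists a.
by rewrite rE /= qia linear0 subr0.
Qed.

(** Pull an extension V of M back to an extension Y of B and extend [g] to Y. Subtracting a map that
    comes from B makes the result vanish on A, so that it descends to V. *)
Lemma ext1_zero_quot C A B M (i : {linear A -> B}) (q : {linear B -> M}) :
  ses i q -> ext1_zero C B ->
  (forall g : {linear A -> C}, exists h : {linear B -> C}, forall x, h (i x) = g x) ->
  ext1_zero C M.
Proof.
move=> iq extB extA U V j r jr g.
have [Y [k [s [k' [b [ks kb' bE sE]]]]]] := ses_pullback2 jr iq.
have [h hE] := extB _ _ _ _ ks g; have [m mE] := extA (h \o k').
have [_ kx bo] := kb'.
have [|f fE] := factor_onto bo (f := h \- (m \o s)).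
  by move=> y /kx[x <-]; rewrite /= sE mE /= subrr.
by exists f => x; rewrite -bE fE /= hE (ses_comp0 _ ks) linear0 subr0.
Qed.

Lemma ext1_zero_pres C M P K (k : {linear K -> P}) (p : {linear P -> M}) :
  projective P -> ses k p ->
  (forall g : {linear K -> C}, exists h : {linear P -> C},
     forall x, h (k x) = g x) ->
  ext1_zero C M.
Proof. by move=> prP kp; apply: ext1_zero_quot kp (ext1_zero_proj prP). Qed.

Lemma rV0_eq0 (x : 'rV[R]_0) : x = 0.
Proof. by apply/rowP => -[]. Qed.

Lemma ses_row0 M : ses (\0 : {linear 'rV[R]_0 -> M}) (idfun : {linear M -> M}).
Proof.
split=> [x _|y|y]; first exact: rV0_eq0; last by exists y.
by split=> [/= ->|[x <-//]]; exists 0.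
Qed.

(** In the stable category, [v \o u] is the identity of M. *)
Definition homotopic_id M N (u : {linear M -> N}) (v : {linear N -> M}) :=
  exists P (s : {linear M -> P}) (t : {linear P -> M}),
    projective P /\ forall x, v (u x) + t (s x) = x.

Definition stable_retract M N :=
  exists (u : {linear M -> N}) (v : {linear N -> M}), homotopic_id u v.

Definition stable_eq M N := exists (u : {linear M -> N}) (v : {linear N -> M}),
  homotopic_id u v /\ homotopic_id v u.

Lemma stable_eq_retract M N :
  stable_eq M N -> stable_retract M N /\ stable_retract N M.
Proof. by case=> u [v [? ?]]; split; [exists u, v|exists v, u]. Qed.

Lemma stable_eq_refl M : stable_eq M M.
Proof.
have H : @homotopic_id M M idfun idfun.
  exists (free_on M), \0, \0; split; first exact: free_on_projective.
  by move=> x /=; rewrite addr0.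
by exists idfun, idfun.
Qed.

Lemma retract_stable M N (u : {linear M -> N}) (v : {linear N -> M}) :
  (forall x, v (u x) = x) -> stable_retract M N.
Proof.
move=> vu; exists u, v, (free_on M), \0, \0.
split=> [|x]; first exact: free_on_projective.
by rewrite vu linear0 addr0.
Qed.

Section Syzygies.
Variables (M N P Q K L : lmodType R).
Variables (k : {linear K -> P}) (p : {linear P -> M}).
Variables (l : {linear L -> Q}) (q : {linear Q -> N}).
Hypotheses (prP : projective P) (kp : ses k p) (lq : ses l q).

Lemma lift_ses (u : {linear M -> N}) :
  exists (U : {linear P -> Q}) (w : {linear K -> L}),
    (forall x, q (U x) = u (p x)) /\ (forall x, l (w x) = U (k x)).
Proof.
have [il lx qo] := lq; have [U UE] := lift_proj (u \o p) prP qo.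
have [|w wE] := factor_inj (f := U \o k) il; last by exists U, w.
by move=> x; apply/lx; rewrite UE /= (ses_comp0 _ kp) linear0.
Qed.

(** The identity of P minus [V \o U] and the lifted homotopy lands in the kernel of [p], which gives
    [e]. The new homotopy factors through [k] itself, so composing it with a map K -> C gives a map
    that extends to P; [ext1_stable] depends on this. *)
Lemma homotopy_syzygy (u : {linear M -> N}) (v : {linear N -> M})
    (U : {linear P -> Q}) (V : {linear Q -> P})
    (w : {linear K -> L}) (z : {linear L -> K}) :
  homotopic_id u v ->
  (forall x, q (U x) = u (p x)) -> (forall x, l (w x) = U (k x)) ->
  (forall x, p (V x) = v (q x)) -> (forall x, k (z x) = V (l x)) ->
  exists e : {linear P -> K}, forall x, z (w x) + e (k x) = x.
Proof.
move=> [T [s [t [prT stE]]]] UE wE VE zE; have [ik kx po] := kp.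
have [t' t'E] := lift_proj t prT po.
pose d : {linear P -> P} := idfun \- (V \o U) \- (t' \o s \o p).
have dE x : d x = x - V (U x) - t' (s (p x)) by [].
have [|e eE] := factor_inj (f := d) ik.
  move=> x; apply/kx; rewrite dE !linearB /= VE UE t'E -addrA -opprD stE.
  by rewrite subrr.
exists e => x; apply: (injI ik).
rewrite linearD zE wE eE dE (ses_comp0 _ kp) !linear0 addr0.
by rewrite addrC subrK.
Qed.
End Syzygies.

Lemma stable_retract_syzygy M N P Q K L
    (k : {linear K -> P}) (p : {linear P -> M})
    (l : {linear L -> Q}) (q : {linear Q -> N}) :
  projective P -> projective Q -> ses k p -> ses l q ->
  stable_retract M N -> stable_retract K L.
Proof.
move=> prP prQ kp lq [u [v uv]].
have [U [w [UE wE]]] := lift_ses prP kp lq u.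
have [V [z [VE zE]]] := lift_ses prQ lq kp v.
have [e eE] := homotopy_syzygy kp uv UE wE VE zE.
by exists w, z, P, k, e.
Qed.

Lemma stable_eq_syzygy M N P Q K L
    (k : {linear K -> P}) (p : {linear P -> M})
    (l : {linear L -> Q}) (q : {linear Q -> N}) :
  projective P -> projective Q -> ses k p -> ses l q ->
  stable_eq M N -> stable_eq K L.
Proof.
move=> prP prQ kp lq [u [v [uv vu]]].
have [U [w [UE wE]]] := lift_ses prP kp lq u.
have [V [z [VE zE]]] := lift_ses prQ lq kp v.
have [e eE] := homotopy_syzygy kp uv UE wE VE zE.
have [e' e'E] := homotopy_syzygy lq vu VE zE UE wE.
by exists w, z; split; [exists P, k, e|exists Q, l, e'].
Qed.

Lemma ext1_zero_retract C M N :
  stable_retract M N -> ext1_zero C N -> ext1_zero C M.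
Proof.
move=> [u [v uv]] extN; have kp := ses_free M; have lq := ses_free N.
have prP := @free_on_projective _ M; have prQ := @free_on_projective _ N.
have [U [w [UE wE]]] := lift_ses prP kp lq u.
have [V [z [VE zE]]] := lift_ses prQ lq kp v.
have [e eE] := homotopy_syzygy kp uv UE wE VE zE.
apply: (ext1_zero_pres prP kp) => g.
have [h hE] := extN _ _ _ _ lq (g \o z).
exists ((h \o U) \+ (g \o e)) => x.
by rewrite /= -wE hE /= -linearD eE.
Qed.

(** The cokernel of P^C -> K^C is Ext^1(M, C) computed from an arbitrary projective cover. [z] and
    [w] induce inverse maps, as the homotopies die in the cokernels. *)
Lemma ext1_stable C M N P Q K L
    (k : {linear K -> P}) (p : {linear P -> M})
    (l : {linear L -> Q}) (q : {linear Q -> N}) :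
  projective P -> projective Q -> ses k p -> ses l q -> stable_eq M N ->
  exists f : {linear coker (precomp k C) -> coker (precomp l C)}, bijective f.
Proof.
move=> prP prQ kp lq [u [v [uv vu]]].
have [U [w [UE wE]]] := lift_ses prP kp lq u.
have [V [z [VE zE]]] := lift_ses prQ lq kp v.
have [e eE] := homotopy_syzygy kp uv UE wE VE zE.
have [e' e'E] := homotopy_syzygy lq vu VE zE UE wE.
have [a [ao ax]] := cokerP (precomp k C).
have [b [bo bx]] := cokerP (precomp l C).
have [|f fE] := factor_onto ao (f := b \o precomp z C).
  move=> _ /ax[h <-]; apply/bx; exists (h \o V : {linear _ -> _}).
  by apply: linear_ext => x /=; rewrite zE.
have [|g gE] := factor_onto bo (f := a \o precomp w C).
  move=> _ /bx[h <-]; apply/ax; exists (h \o U : {linear _ -> _}).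
  by apply: linear_ext => x /=; rewrite wE.
exists f; exists g => [x|y].
  have [m <-] := ao x; rewrite fE gE /=; apply/eqP; rewrite -subr_eq0 -linearB.
  apply/eqP/ax; exists (- (m \o e) : {linear _ -> _}).
  apply: linear_ext => t; rewrite /= -[X in _ = _ - m X]eE linearD opprD addrA.
  by rewrite subrr add0r.
have [m <-] := bo y; rewrite gE fE /=; apply/eqP; rewrite -subr_eq0 -linearB.
apply/eqP/bx; exists (- (m \o e') : {linear _ -> _}).
apply: linear_ext => t; rewrite /= -[X in _ = _ - m X]e'E linearD opprD addrA.
by rewrite subrr add0r.
Qed.

(** Vanishing of Ext^(i+1)(M, C) by dimension shifting; index 0 stands for degree 1. *)
Definition extS_zero C i M := ext1_zero C (iter i (@syzygy R) M).

Lemma extS_zero_retract C i M N :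
  stable_retract M N -> extS_zero C i N -> extS_zero C i M.
Proof.
move=> MN; apply: ext1_zero_retract.
elim: i => //= i IH.
by apply: stable_retract_syzygy IH; try exact: ses_free; exact: free_on_projective.
Qed.

Lemma extS_zero_syzygy C i M P K (k : {linear K -> P}) (p : {linear P -> M}) :
  projective P -> ses k p -> extS_zero C i.+1 M <-> extS_zero C i K.
Proof.
move=> prP kp; rewrite /extS_zero iterSr -/(extS_zero C i _).
have /stable_eq_retract[H1 H2] : stable_eq (syzygy M) K.
  apply: (stable_eq_syzygy _ prP (ses_free M) kp (stable_eq_refl M)).
  exact: free_on_projective.
by split; apply: extS_zero_retract.
Qed.

Lemma projective_row0 : projective 'rV[R]_0.
Proof.
by move=> U V g f _; exists \0 => x; rewrite (rV0_eq0 x) !linear0.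
Qed.

(** The identity of P factors through a projective, so P is a stable retract of the zero module
    ['rV[R]_0], which is its own syzygy. *)
Lemma extS_zero_proj C i P : projective P -> extS_zero C i P.
Proof.
move=> prP; apply: (@extS_zero_retract _ _ _ 'rV[R]_0).
  by exists \0, \0, P, idfun, idfun; split=> // x /=; rewrite add0r.
elim: i => [|i IH]; first exact: ext1_zero_proj projective_row0.
exact/(extS_zero_syzygy C i projective_row0 (ses_row0 _)).
Qed.

Lemma stable_retract_addl A P : projective P -> stable_retract (A * P)%type A.
Proof.
move=> prP; have [f fE] := ex_fst A P; have [s sE] := ex_snd A P.
have [i iE] := ex_pair (idfun : {linear A -> A}) (\0 : {linear A -> P}).
have [t tE] := ex_pair (\0 : {linear P -> A}) (idfun : {linear P -> P}).
exists f, i, P, s, t; split=> // -[x y].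
by rewrite iE tE fE sE /=; congr (_, _); rewrite ?addr0 ?add0r.
Qed.

Lemma stable_retract_addr A P : stable_retract A (A * P)%type.
Proof.
have [f fE] := ex_fst A P.
have [i iE] := ex_pair (idfun : {linear A -> A}) (\0 : {linear A -> P}).
by apply: (@retract_stable _ _ i f) => x; rewrite iE fE.
Qed.

(** W is the preimage of the submodule A under [r]: V/W is B/A, and W is an extension of A by the
    kernel U. *)
Lemma ses_preimage A B M U V (a : {linear A -> B}) (q : {linear B -> M})
    (j : {linear U -> V}) (r : {linear V -> B}) :
  ses a q -> ses j r ->
  exists W (b : {linear W -> V}) (j' : {linear U -> W}) (r' : {linear W -> A}),
  [/\ ses b (q \o r), ses j' r' & forall x, b (j' x) = j x].
Proof.
move=> [ai ax ao] jr; have [_ _ ro] := jr.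
have [W [j' [r' [b [jr' jE bE [ex_b b_inj]]]]]] := ses_pullback a jr.
exists W, b, j', r'; split=> //; split.
- by move=> y y0; apply: (b_inj y y0); apply: ai; rewrite -bE y0 linear0.
- move=> x; split=> [/ax[z zE]|[y <-]].
    by have [y [<- _]] := ex_b _ _ (esym zE); exists y.
  by rewrite /= bE; apply/ax; exists (r' y).
- move=> m; have [y yE] := ao m; have [x xE] := ro y.
  by exists x; rewrite /= xE.
Qed.

(* Three rotations turn A -> B -> M into Omega A -> Omega B -> Omega M, up to
   projective summands. *)
Lemma extS_zero_ses C i A B M (a : {linear A -> B}) (q : {linear B -> M}) :
  ses a q -> extS_zero C i A -> extS_zero C i M -> extS_zero C i B.
Proof.
elim: i A B M a q => [|i IH] A B M a q aq.
  move=> extA extM U V j r jr g.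
  have [W [b [j' [r' [bc jr' bE]]]]] := ses_preimage aq jr.
  have [g1 g1E] := extA _ _ _ _ jr' g; have [g2 g2E] := extM _ _ _ _ bc g1.
  by exists g2 => x; rewrite -bE g2E g1E.
move=> extA extM; have pr := @free_on_projective R.
have [_ [_ [a1 [q1 [aq1 _ _ _ _]]]]] := ses_rotate (pr _) aq (ses_free M).
have [_ [_ [a2 [q2 [aq2 _ _ _ _]]]]] := ses_rotate (pr _) aq1 (ses_free B).
have [_ [_ [a3 [q3 [aq3 _ _ _ _]]]]] := ses_rotate (pr _) aq2 (ses_free _).
apply/(extS_zero_syzygy C i (pr B) (ses_free B)).
apply: extS_zero_retract (stable_retract_addr _ _) _.
apply: IH aq3 _ _.
  apply/(extS_zero_syzygy C i (pr _) (ses_free _)).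
  by apply: extS_zero_retract extA; apply: stable_retract_addl.
apply: extS_zero_retract (stable_retract_addl _ (pr _)) _.
exact/(extS_zero_syzygy C i (pr _) (ses_free _)).
Qed.

(** One rotation makes A, up to a projective summand, the middle term of a sequence from Omega M to
    B. *)
Lemma extS_zero_ses_l C i A B M (a : {linear A -> B}) (q : {linear B -> M}) :
  ses a q -> extS_zero C i B -> extS_zero C i.+1 M -> extS_zero C i A.
Proof.
move=> aq extB extM; have pr := @free_on_projective R.
have [_ [_ [a1 [q1 [aq1 _ _ _ _]]]]] := ses_rotate (pr _) aq (ses_free M).
apply: extS_zero_retract (stable_retract_addr _ _) (extS_zero_ses aq1 _ extB).
exact/(extS_zero_syzygy C i (pr _) (ses_free _)).
Qed.

Lemma extS_zero_ses_r C i A B M (a : {linear A -> B}) (q : {linear B -> M}) :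
  ses a q -> extS_zero C i A -> extS_zero C i.+1 B -> extS_zero C i.+1 M.
Proof.
move=> aq extA extB; have pr := @free_on_projective R.
have [_ [_ [a1 [q1 [aq1 _ _ _ _]]]]] := ses_rotate (pr _) aq (ses_free M).
apply/(extS_zero_syzygy C i (pr _) (ses_free _)).
apply: (extS_zero_ses_l aq1) extB.
by apply: extS_zero_retract extA; apply: stable_retract_addl.
Qed.

Definition ext_zero C M := forall i, extS_zero C i M.

Lemma ext_zero_ses C A B M (a : {linear A -> B}) (q : {linear B -> M}) :
  ses a q -> ext_zero C A -> ext_zero C M -> ext_zero C B.
Proof. by move=> aq extA extM i; apply: extS_zero_ses aq (extA i) (extM i). Qed.

Lemma ext_zero_ses_l C A B M (a : {linear A -> B}) (q : {linear B -> M}) :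
  ses a q -> ext_zero C B -> ext_zero C M -> ext_zero C A.
Proof. by move=> aq extB extM i; apply: extS_zero_ses_l aq (extB i) (extM i.+1). Qed.

(** Degree 1 is a separate hypothesis: the vanishing for A and B controls Ext of M only from degree
    2 on. *)
Lemma ext_zero_ses_r C A B M (a : {linear A -> B}) (q : {linear B -> M}) :
  ses a q -> ext_zero C A -> ext_zero C B -> ext1_zero C M -> ext_zero C M.
Proof.
by move=> aq extA extB extM [|i] //; apply: extS_zero_ses_r aq (extA i) (extB i.+1).
Qed.

Lemma ext_zero_proj C P : projective P -> ext_zero C P.
Proof. by move=> prP i; apply: extS_zero_proj. Qed.

Lemma ext_zero_retract C M N : stable_retract M N -> ext_zero C N -> ext_zero C M.
Proof. by move=> MN extN i; apply: extS_zero_retract MN (extN i). Qed.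

Lemma same_ker_iso V A B (a : {linear V -> A}) (b : {linear V -> B}) :
  onto a -> onto b -> (forall x, a x = 0 <-> b x = 0) ->
  exists f : {linear A -> B}, bijective f.
Proof.
move=> ao bo ab.
have [|f fE] := factor_onto ao (f := b); first by move=> x /ab.
have [|g gE] := factor_onto bo (f := a); first by move=> x /ab.
exists f; exists g => x; first by have [y <-] := ao x; rewrite fE gE.
by have [y <-] := bo x; rewrite gE fE.
Qed.

(* Both sides are quotients of Hom(Omega^(i+1) M, C) with the same kernel. *)
Lemma Ext_coker C M i (X := iter i (@syzygy R) M) :
  exists f : {linear Ext i.+1 M C -> coker (precomp (ker_incl (free_cover X)) C)},
    bijective f.
Proof.
set k := ker_incl _; set d := res_d (free_resolution M) i.
set d' := res_d (free_resolution M) i.+1.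
have [a [ao ax]] := cokerP (precomp k C).
have [b [bo bx]] :=
  quot_projP (preim_mod (ker_incl (precomp d' C)) (im_mod (precomp d C))).
set c := free_cover (syzygy X).
have co : onto c by exact: free_cover_onto.
have dE x : d x = k (c x) by [].
have d'E x : d' x = ker_incl c (free_cover (syzygy (syzygy X)) x) by [].
have [|e eE] := factor_inj (f := precomp c C) (@ker_incl_inj _ _ _ (precomp d' C)).
  move=> g; apply: ker_inclP; apply: linear_ext => x.
  have cd0 : c (d' x) = 0 by rewrite d'E ker_val0.
  by rewrite -[LHS]/(g (c (d' x))) cd0 linear0.
have eo : onto e.
  move=> h; have h0 := ker_val0 h.
  have [|g gE] := factor_onto co (f := ker_incl _ h).
    move=> x /ker_inclP[y <-].
    have [z <-] := free_cover_onto y.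
    by rewrite -d'E -[LHS]/((precomp d' C (ker_incl _ h) : {linear _ -> _}) z) h0.
  exists g; apply: (injI (@ker_incl_inj _ _ _ (precomp d' C))).
  by rewrite eE; apply: linear_ext.
apply: (same_ker_iso (a := b \o e) _ ao) => [y|g].
  by have [x <-] := bo y; have [g <-] := eo x; exists g.
rewrite /= bx ax; split.
  move=> /asboolP[m]; rewrite eE => mE; exists m.
  apply: linear_ext => y; have [x <-] := co y.
  by rewrite -[RHS]/((precomp c C g : {linear _ -> _}) x) -mE.
move=> [m mE]; apply/asboolP; exists m; rewrite eE -mE.
exact: linear_ext.
Qed.

Lemma zero_module_bij M N (f : {linear M -> N}) :
  bijective f -> zero_module M <-> zero_module N.
Proof.
move=> bf; split=> H x; last exact: (bijective_inj bf (H (f x))).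
by have [y <-] := bijective_onto bf x; rewrite (H y) linear0.
Qed.

Lemma Ext_zero C M i : zero_module (Ext i.+1 M C) <-> extS_zero C i M.
Proof.
have [f bf] := Ext_coker C M i; rewrite (zero_module_bij bf).
set X := iter i _ _; have Xses := ses_free X.
have [a [ao ax]] := cokerP (precomp (ker_incl (free_cover X)) C).
split=> [H|H x].
  apply: (ext1_zero_pres (@free_on_projective _ X) Xses) => g.
  have /ax[h hE] : a g = 0 by exact: H.
  by exists h => x; rewrite -hE.
have [g <-] := ao x; apply/ax; have [h hE] := H _ _ _ _ Xses g.
by exists h; apply: linear_ext.
Qed.

Lemma Ext_zeroS C M :
  (forall i, (0 < i)%N -> zero_module (Ext i M C)) <-> ext_zero C M.
Proof.
by split=> [H i|H [|i] // _]; [apply/Ext_zero/H|apply/Ext_zero].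
Qed.
End StableEquivalence.

(** * Finitely generated modules over a Noetherian ring *)

Section FiniteModules.
Variable R : comNzRingType.
Implicit Types A B C K M N U V X Y : lmodType R.

Lemma finite_module_fin (T : finType) M (e : T -> M) :
  (forall x, exists c : T -> R, x = \sum_t c t *: e t) -> finite_module M.
Proof.
move=> H; exists #|T|, (e \o enum_val) => x; have [c ->] := H x.
exists (c \o enum_val); rewrite (reindex (@enum_val T predT)) //=.
by apply: onW_bij; apply: enum_val_bij.
Qed.

Lemma finite_module_zero M : zero_module M -> finite_module M.
Proof.
by move=> M0; exists 0%N, (fun=> 0) => x; exists (fun=> 0); rewrite (M0 x) big_ord0.
Qed.

Lemma finite_module_onto U V (f : {linear U -> V}) :
  onto f -> finite_module U -> finite_module V.
Proof.
move=> fo [n [e eE]]; exists n, (f \o e) => y; have [x <-] := fo y.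
have [c ->] := eE x; exists c; rewrite linear_sum.
by apply: eq_bigr => i _; rewrite linearZ.
Qed.

Lemma finite_module_ker B V (f : {linear B -> V}) m (e : 'I_m -> B) :
  (forall b, exists c : 'I_m -> R, f b = \sum_i c i *: f (e i)) ->
  finite_module (ker_mod f) -> finite_module B.
Proof.
move=> fE [n [k kE]].
apply: (@finite_module_fin ('I_m + 'I_n)%type _
  (fun s => match s with inl i => e i | inr j => ker_incl f (k j) end)) => b.
have [c cE] := fE b.
have /ker_inclP[x xE] : f (b - \sum_i c i *: e i) = 0.
  rewrite linearB linear_sum /= cE; apply/eqP; rewrite subr_eq0; apply/eqP.
  by apply: eq_bigr => i _; rewrite linearZ.
have [d dE] := kE x.
exists (fun s => match s with inl i => c i | inr j => d j end).
rewrite big_sumType /= -[LHS](subrK (\sum_i c i *: e i)) -xE addrC; congr (_ + _).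
by rewrite dE linear_sum; apply: eq_bigr => i _; rewrite linearZ.
Qed.

Lemma finite_module_ses A B M (i : {linear A -> B}) (q : {linear B -> M}) :
  ses i q -> finite_module A -> finite_module M -> finite_module B.
Proof.
move=> [ii ix qo] finA [m [e eE]]; have [s sK] := boolp.choice qo.
apply: (@finite_module_ker _ _ q m (s \o e)) => [b|].
  by have [c ->] := eE (q b); exists c; apply: eq_bigr => j _; rewrite /= sK.
have [a|f fE] := factor_inj (f := i) (@ker_incl_inj _ _ _ q).
  by apply: ker_inclP; apply/ix; exists a.
apply: (finite_module_onto (f := f)) finA => k.
have /ix[a aE] := ker_val0 k; exists a.
by apply: (injI (@ker_incl_inj _ _ _ q)); rewrite fE.
Qed.

Lemma row_cover M : finite_module M ->
  exists n (f : {linear 'rV[R]_n -> M}), onto f.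
Proof.
move=> [n [e eE]].
have [|f fE] := @ex_linear R 'rV[R]_n M (fun v => \sum_i v 0 i *: e i).
  move=> a x y; rewrite scaler_sumr -big_split; apply: eq_bigr => i _ /=.
  by rewrite !mxE scalerDl scalerA.
exists n, f => x; have [c ->] := eE x; exists (\row_i c i).
by rewrite fE; apply: eq_bigr => i _; rewrite mxE.
Qed.

Lemma projective_row n : projective 'rV[R]_n.
Proof.
move=> U V g f go; have [s sK] := boolp.choice go.
have [|h hE] := @ex_linear R 'rV[R]_n U
    (fun v => \sum_i v 0 i *: s (f (delta_mx 0 i))).
  move=> a x y; rewrite scaler_sumr -big_split; apply: eq_bigr => i _ /=.
  by rewrite !mxE scalerDl scalerA.
exists h => v; rewrite hE [in RHS](row_sum_delta v) !linear_sum.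
by apply: eq_bigr => i _; rewrite !linearZ /= sK.
Qed.

Lemma finite_module_row n : finite_module 'rV[R]_n.
Proof.
exists n, (fun i => delta_mx 0 i) => v; exists (fun i => v 0 i).
exact: row_sum_delta.
Qed.

(** Induction on n along the first coordinate: its image is an ideal, hence finitely generated, and
    its kernel embeds into R^(n-1). *)
Lemma noetherian_sub_row n N (i : {linear N -> 'rV[R]_n}) :
  noetherian R -> injective0 i -> finite_module N.
Proof.
move=> noethR; elim: n N i => [|n IH] N i ii.
  by apply: finite_module_zero => x; apply: ii; apply: rV0_eq0.
have [|f fE] := @ex_linear R N R^o (fun x => i x 0 0).
  by move=> a x y; rewrite linearP !mxE.
have [|m [e eE]] := noethR [set a : R | exists x, f x = a]%classic.
  split=> [|_ _ [x <-] [y <-]|a _ [x <-]].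
  - by exists 0; rewrite linear0.
  - by exists (x + y); rewrite linearD.
  - by exists (a *: x); rewrite linearZ.
have inI j : exists x, f x = e j.
  have /(congr1 (fun S : set R => S (e j))) /= -> := eE.
  exists (fun k => (k == j)%:R); rewrite (bigD1 j) //= eqxx mul1r big1 ?addr0 //.
  by move=> k /negPf ->; rewrite mul0r.
have [s sE] := boolp.choice inI.
apply: (@finite_module_ker _ _ f m s) => [b|].
  have : [set a : R | exists x, f x = a]%classic (f b) by exists b.
  rewrite eE /= => -[c cE]; exists c; rewrite cE; apply: eq_bigr => j _.
  by rewrite sE.
have [|g gE] := @ex_linear R (ker_mod f) 'rV[R]_n
    (fun x => \row_j i (ker_incl f x) 0 (lift ord0 j)).
  by move=> a x y; apply/rowP => j; rewrite !mxE !linearP !mxE.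
apply: (IH _ g) => x gx; apply: (@ker_incl_inj _ _ _ f); apply: ii.
apply/rowP => j; rewrite mxE; case: (unliftP ord0 j) => [k|] ->.
  by move/rowP: gx => /(_ k); rewrite gE !mxE.
by rewrite -fE ker_val0.
Qed.

Lemma noetherian_sub M N (i : {linear N -> M}) :
  noetherian R -> finite_module M -> injective0 i -> finite_module N.
Proof.
move=> noethR /row_cover[n [f fo]] ii.
have [Y [j [r [b [[_ _ ro] _ bE [_ b_inj]]]]]] := ses_pullback i (ses_ker fo).
apply: finite_module_onto ro (noetherian_sub_row (i := b) noethR _) => y y0.
by apply: (b_inj y y0); apply: ii; rewrite -bE y0 linear0.
Qed.

Lemma finite_module_ffun n M : finite_module M -> finite_module {ffun 'I_n -> M}.
Proof.
move=> [m [e eE]].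
apply: (@finite_module_fin ('I_n * 'I_m)%type _
  (fun t => [ffun k => if k == t.1 then e t.2 else 0])) => f.
have [c cE] := boolp.choice (fun k => eE (f k)).
exists (fun t => c t.1 t.2); apply/ffunP => k; rewrite cE sum_ffunE.
rewrite -(pair_bigA _ (fun j l =>
  (c j l *: [ffun k0 => if k0 == j then e l else 0] : {ffun _ -> _}) k)) /=.
rewrite [RHS](bigD1 k) //= [X in _ + X]big1 => [|j jk].
  by rewrite addr0; apply: eq_bigr => l _; rewrite !ffunE eqxx.
by apply: big1 => l _; rewrite !ffunE eq_sym (negPf jk) scaler0.
Qed.

(** Evaluation at n generators of X embeds [hom X C] into C^n. *)
Lemma finite_module_hom X C :
  noetherian R -> finite_module X -> finite_module C -> finite_module (hom X C).
Proof.
move=> noethR [n [e eE]] finC.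
have [|f fE] := @ex_linear R (hom X C) {ffun 'I_n -> C}
    (fun g : {linear X -> C} => [ffun i => g (e i)]).
  by move=> a g h; apply/ffunP => i; rewrite !ffunE.
apply: (noetherian_sub (i := f) noethR (finite_module_ffun n finC)) => g g0.
apply: linear_ext => x; have [c ->] := eE x.
rewrite linear_sum big1 //= => i _; rewrite linearZ /=.
have := fE g; rewrite g0 => /ffunP/(_ i); rewrite !ffunE => <-.
by rewrite scaler0.
Qed.
End FiniteModules.

(** * Closure properties of totally C-reflexive modules *)

Section TotallyReflexive.
Variables (R : comNzRingType) (C : lmodType R).
Hypotheses (noethR : noetherian R) (semiC : semidualizing C).
Implicit Types A B K L M N P T U V W X Y : lmodType R.

Local Notation reflexive := (totally_reflexive C).

Lemma totally_reflexiveP X : reflexive X <->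
  [/\ finite_module X, bijective (biduality C X), ext_zero C X
    & ext_zero C (hom X C)].
Proof. by split=> -[finX biX /Ext_zeroS extX /Ext_zeroS extX']. Qed.

Lemma ses_dual1 A B M (i : {linear A -> B}) (q : {linear B -> M}) :
  ses i q -> ext1_zero C M -> ses (precomp q C) (precomp i C).
Proof.
move=> iq extM; have [_ ix qo] := iq; have [qi qx] := ses_dual C ix qo.
split=> // g; have [h hE] := extM _ _ _ _ iq g.
by exists h; apply: linear_ext.
Qed.

Lemma biduality_nat U V (f : {linear U -> V}) x :
  precomp (precomp f C) C (biduality C U x) = biduality C V (f x).
Proof. exact: linear_ext. Qed.

Lemma ses_bidual A B M (i : {linear A -> B}) (q : {linear B -> M}) :
  ses i q -> ext1_zero C M ->
  injective0 (precomp (precomp i C) C) /\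
  exact_at (precomp (precomp i C) C) (precomp (precomp q C) C).
Proof. by move=> iq /(ses_dual1 iq)[_ ex io]; apply: ses_dual. Qed.

Lemma totally_reflexive_ses A B T (i : {linear A -> B}) (q : {linear B -> T}) :
  ses i q -> reflexive A -> reflexive T -> reflexive B.
Proof.
move=> iq /totally_reflexiveP[finA bA extA extA'].
move=> /totally_reflexiveP[finT bT extT extT'].
have extB := ext_zero_ses iq extA extT.
have [i2 x2] := ses_bidual iq (extT 0%N); have [ii ix qo] := iq.
apply/totally_reflexiveP; split=> //; first exact: finite_module_ses iq finA finT.
  apply: bijective_of => [b b0|y].
    have /ix[a aE] : q b = 0.
      by apply: (bijective_inj bT); rewrite -biduality_nat b0 linear0.
    rewrite -aE in b0 *; suff -> : a = 0 by rewrite linear0.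
    by apply: (bijective_inj bA); apply: i2; rewrite biduality_nat.
  have [t tE] := bijective_onto bT (precomp (precomp q C) C y).
  have [b bE] := qo t.
  have /x2[z zE] : precomp (precomp q C) C (y - biduality C B b) = 0.
    by rewrite linearB /= biduality_nat bE tE subrr.
  have [a aE] := bijective_onto bA z.
  exists (i a + b); rewrite linearD /= -biduality_nat aE zE.
  exact: subrK.
exact: ext_zero_ses (ses_dual1 iq (extT 0%N)) extT' extA'.
Qed.

Lemma totally_reflexive_ses_l A B T (i : {linear A -> B}) (q : {linear B -> T}) :
  ses i q -> reflexive B -> reflexive T -> reflexive A.
Proof.
move=> iq /totally_reflexiveP[finB bB extB extB'].
move=> /totally_reflexiveP[finT bT extT extT'].
have [i2 x2] := ses_bidual iq (extT 0%N); have [ii ix qo] := iq.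
have iq' := ses_dual1 iq (extT 0%N).
apply/totally_reflexiveP; split; first exact: noetherian_sub noethR finB ii.
- apply: bijective_of => [a a0|z].
    by apply: ii; apply: (bijective_inj bB); rewrite -biduality_nat a0 linear0.
  have [b bE] := bijective_onto bB (precomp (precomp i C) C z).
  have /ix[a aE] : q b = 0.
    apply: (bijective_inj bT); rewrite -biduality_nat bE.
    by apply/x2; exists z.
  exists a; by apply: (injI i2); rewrite biduality_nat aE.
- exact: ext_zero_ses_l iq extB extT.
apply: (ext_zero_ses_r iq' extT' extB').
(* Ext^1(A^C, C) = 0: a map T^C -> C is evaluation at some t in T, and evaluation at a preimage b of
   t extends it to B^C. *)
apply: (ext1_zero_quot iq' (extB' 0%N)) => g.
have [t tE] := bijective_onto bT g; have [b bE] := qo t.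
by exists (biduality C B b) => x; rewrite -tE -bE.
Qed.

Lemma totally_reflexive_zero X : zero_module X -> reflexive X.
Proof.
move=> X0; have X'0 : zero_module (hom X C).
  by move=> f; apply: linear_ext => x; rewrite (X0 x) linear0.
have pr0 Y : zero_module Y -> projective Y.
  move=> Y0 U V g f _; exists \0 => x; by rewrite (Y0 x) !linear0.
apply/totally_reflexiveP; split; first exact: finite_module_zero.
- apply: bijective_of => [x _|y]; first exact: X0.
  by exists 0; apply: linear_ext => f; rewrite (X'0 f) !linear0.
- exact/ext_zero_proj/pr0.
- exact/ext_zero_proj/pr0.
Qed.

(** Semidualizing is used here: through [psi], identifying C with Hom(R, C), biduality of R becomes
    the homothety map and Ext(R^C, C) becomes Ext(C, C). *)
Lemma totally_reflexive_base : reflexive R^o.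
Proof.
have [finC bC /Ext_zeroS extC] := semiC.
have [psi psiE] : exists psi : {linear C -> hom R^o C},
    forall c (a : R^o), (psi c : {linear _ -> _}) a = a *: c.
  have lin (c : C) : linear (fun a : R^o => a *: c).
    by move=> a x y; rewrite scalerDl scalerA.
  have [h hE] := boolp.choice (fun c => ex_linear (lin c)).
  have [|g gE] := @ex_linear R C (hom R^o C) h.
    move=> a x y; apply: linear_ext => b.
    by rewrite hE /= !hE scalerDr !scalerA mulrC.
  by exists g => c a; rewrite gE hE.
apply/totally_reflexiveP; split.
- by exists 1%N, (fun=> 1) => x; exists (fun=> x); rewrite big_ord1 [RHS]mulr1.
- apply: bijective_of => [a a0|phi].
    apply: (bijective_inj bC); apply: linear_ext => c /=.
    rewrite -psiE -[LHS]/((biduality C R^o a : {linear _ -> _}) (psi c)).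
    by rewrite a0.
  have [a aE] := bijective_onto bC (phi \o psi : {linear _ -> _}).
  exists a; apply: linear_ext => f.
  have -> : f = psi ((f : {linear _ -> _}) 1).
    by apply: linear_ext => b; rewrite psiE -linearZ; congr (f _); rewrite [RHS]mulr1.
  move/(congr1 (fun h : {linear C -> C} => h ((f : {linear _ -> _}) 1))): aE => /= <-.
  by rewrite -[LHS]/((psi _ : {linear _ -> _}) a) psiE.
- have [|u uE] := @ex_linear R R^o 'rV[R]_1 (fun a => a%:M).
    by move=> a x y; rewrite raddfD /= -scale_scalar_mx.
  have [|v vE] := @ex_linear R 'rV[R]_1 R^o (fun x => x 0 0).
    by move=> a x y; rewrite !mxE.
  apply: (@ext_zero_retract _ _ _ 'rV[R]_1).
    by apply: (@retract_stable _ _ _ u v) => x; rewrite vE uE mxE.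
  exact/ext_zero_proj/projective_row.
- have [|u uE] := @ex_linear R (hom R^o C) C (fun f : {linear _ -> _} => f 1).
    by [].
  apply: ext_zero_retract extC; apply: (@retract_stable _ _ _ u psi) => f.
  apply: linear_ext => a; rewrite psiE uE -linearZ; congr (f _).
  by rewrite [LHS]mulr1.
Qed.

Lemma totally_reflexive_row n : reflexive 'rV[R]_n.
Proof.
elim: n => [|n IH]; first exact/totally_reflexive_zero/rV0_eq0.
have [|u uE] := @ex_linear R 'rV[R]_n 'rV[R]_(1 + n) (fun x => row_mx 0 x).
  by move=> a x y; rewrite scale_row_mx add_row_mx scaler0 add0r.
have [|v vE] := @ex_linear R 'rV[R]_(1 + n) R^o (fun x => x 0 0).
  by move=> a x y; rewrite !mxE.
apply: (@totally_reflexive_ses 'rV[R]_n 'rV[R]_(1 + n) R^o u v) IH totally_reflexive_base.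
split=> [x|x|a].
- by rewrite uE -(row_mx0 R 1) => /eq_row_mx[].
- have o0 : 0 = lshift n (0 : 'I_1) by apply: val_inj.
  rewrite vE; split=> [x0|[y <-]]; last by rewrite uE o0 row_mxEl mxE.
  exists (rsubmx x); rewrite uE -[RHS]hsubmxK; congr row_mx.
  by apply/rowP => j; rewrite (ord1 j) !mxE -x0 o0.
- have o0 : 0 = lshift n (0 : 'I_1) by apply: val_inj.
  by exists (row_mx a%:M 0); rewrite vE o0 row_mxEl mxE.
Qed.

(** P is a direct summand of some R^n, and biduality is natural with respect to the inclusion and
    the projection. *)
Lemma totally_reflexive_proj P : finite_module P -> projective P -> reflexive P.
Proof.
move=> finP prP; have [n [f fo]] := row_cover finP.
have [s sE] := prP _ _ f idfun fo.
have /totally_reflexiveP[_ bF extF extF'] := totally_reflexive_row n.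
apply/totally_reflexiveP; split=> //.
- apply: bijective_of => [x x0|phi].
    rewrite -[x]sE /=; have -> : s x = 0.
      by apply: (bijective_inj bF); rewrite -biduality_nat x0 linear0.
    by rewrite linear0.
  have [y yE] := bijective_onto bF (precomp (precomp s C) C phi).
  exists (f y); rewrite -biduality_nat yE; apply: linear_ext => g.
  by congr (phi _); apply: linear_ext => x /=; rewrite sE.
- exact: ext_zero_proj.
apply: ext_zero_retract extF'.
apply: (@retract_stable _ _ _ (precomp f C) (precomp s C)) => g.
by apply: linear_ext => x /=; rewrite sE.
Qed.

(** By the triangle identity, biduality of X^C is inverse to the dual of biduality of X. *)
Lemma totally_reflexive_hom X : reflexive X -> reflexive (hom X C).
Proof.
move=> /totally_reflexiveP[finX bX extX extX']; have [finC _ _] := semiC.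
apply/totally_reflexiveP; split=> //; first exact: finite_module_hom.
  apply: bijective_of => [f f0|Phi].
    apply: linear_ext => x.
    rewrite -[LHS]/((biduality C _ f : {linear _ -> _}) (biduality C X x)).
    by rewrite f0.
  exists (Phi \o biduality C X : {linear _ -> _}); apply: linear_ext => phi.
  by have [x <-] := bijective_onto bX phi.
have [|g gE] := factor_onto (bijective_onto bX) (f := idfun).
  by move=> x /(bijective_inj bX).
apply: ext_zero_retract extX; apply: (@retract_stable _ _ _ g (biduality C X)) => phi.
by have [x <-] := bijective_onto bX phi; rewrite gE.
Qed.

(** A recursive form of [has_gdim_le] that peels off one syzygy at a time; [has_gdim_leP] proves the
    two equivalent. *)
Fixpoint gdim_le n M : Prop :=
  if n is m.+1 then
    exists (K X : lmodType R) (k : {linear K -> X}) (p : {linear X -> M}),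
      [/\ ses k p, reflexive X & gdim_le m K]
  else reflexive M.

Lemma ses_addr M P K X (k : {linear K -> X}) (p : {linear X -> M}) : ses k p ->
  exists (j : {linear K -> (X * P)%type})
    (r : {linear (X * P)%type -> (M * P)%type}),
    ses j r.
Proof.
move=> [ki kx po]; have [f fE] := ex_fst X P; have [s sE] := ex_snd X P.
have [j jE] := ex_pair k (\0 : {linear K -> P}).
have [r rE] := ex_pair (p \o f : {linear _ -> _}) s.
exists j, r; split=> [x|[x y]|[m y]].
- by rewrite jE => -[/ki].
- rewrite rE sE /= fE /=; split=> [[/kx[z <-] ->]|[z]]; first by exists z; rewrite jE.
  by rewrite jE => -[<- <-]; congr (_, _); apply/kx; exists z.
- by have [x <-] := po m; exists (x, y); rewrite rE sE /= fE.
Qed.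

Lemma ses_sum A P :
  exists (i : {linear A -> (A * P)%type}) (s : {linear (A * P)%type -> P}),
  ses i s.
Proof.
have [s sE] := ex_snd A P.
have [i iE] := ex_pair (idfun : {linear A -> A}) (\0 : {linear A -> P}).
exists i, s; split=> [x|[x y]|y]; first by rewrite iE => -[].
  rewrite sE /=; split=> [->|[z]]; first by exists x; rewrite iE.
  by rewrite iE => -[].
by exists (0, y); rewrite sE.
Qed.

(** From B to A: for a reflexive cover X of B, the preimage W of A in X is reflexive, being the
    kernel of X -> T, and it covers A with the same kernel K. *)
Lemma gdim_le_ses n A B T (i : {linear A -> B}) (q : {linear B -> T}) :
  ses i q -> reflexive T -> gdim_le n A <-> gdim_le n B.
Proof.
elim: n A B T i q => [|n IH] A B T i q iq reT.
  split=> [reA|reB]; first exact: totally_reflexive_ses iq reA reT.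
  exact: totally_reflexive_ses_l iq reB reT.
split=> -[K [X [k [p [kp reX gK]]]]]; last first.
  have [W [b [k' [p' [bc kp' _]]]]] := ses_preimage iq kp.
  by exists K, W, k', p'; split=> //; apply: totally_reflexive_ses_l bc reX reT.
(* From A to B: with F free covering T and O its kernel, B is a quotient of A x F by O. If X covers
   A with kernel K, then X x F covers B with kernel the preimage W of O, an extension of O by K, to
   which the induction applies. *)
have [finT _ _ _] := reT; have [m [f fo]] := row_cover finT.
have reF := totally_reflexive_row m; have fs := ses_ker fo.
have reO := totally_reflexive_ses_l fs reF reT.
have [_ [_ [a [r [ar _ _ _ _]]]]] := ses_rotate (@projective_row R m) iq fs.
have [j [s js]] := ses_addr 'rV[R]_m kp.
have [W [b [j' [s' [bc js' _]]]]] := ses_preimage ar js.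
have [i1 [s1 is1]] := ses_sum X 'rV[R]_m.
exists W, (X * 'rV[R]_m)%type, b, (r \o s); split=> //.

  exact: totally_reflexive_ses is1 reX reF.
exact/(IH _ _ _ _ _ js' reO).
Qed.
End TotallyReflexive.

(** * Independence of the G_C-dimension from the chosen covers *)

Section GorensteinDimension.
Variables (R : comNzRingType) (C : lmodType R).
Hypotheses (noethR : noetherian R) (semiC : semidualizing C).
Implicit Types A B K L M N P T U V W X Y E : lmodType R.

Local Notation reflexive := (totally_reflexive C).

(** In the pullback Y of two reflexive covers X and X' of M, the kernels K and K' have the reflexive
    quotients X' and X, so both satisfy the same bounds as Y. *)
Lemma gdim_le_syzygy n M K X (k : {linear K -> X}) (p : {linear X -> M}) :
  ses k p -> reflexive X -> gdim_le C n.+1 M <-> gdim_le C n K.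
Proof.
move=> kp reX; split=> [[K' [X' [k' [p' [kp' reX' gK']]]]]|gK]; last first.
  by exists K, X, k, p.
have [Y [j [r [j' [b [jr jb _ _]]]]]] := ses_pullback2 kp kp'.
apply/(gdim_le_ses noethR semiC n jr reX').
exact/(gdim_le_ses noethR semiC n jb reX).
Qed.

Lemma gdim_le_iso n A B (f : {linear A -> B}) :
  bijective f -> gdim_le C n A <-> gdim_le C n B.
Proof.
move=> bf; pose z : {linear B -> 'rV[R]_0} := \0.
apply: (gdim_le_ses noethR semiC n (i := f) (q := z)).
  split=> [|y|y]; first exact: bijective_inj.
    by split=> // _; apply: bijective_onto.
  by exists 0; rewrite (rV0_eq0 y).
exact: totally_reflexive_row.
Qed.

(** Only the objects of the new resolution are recorded, because [has_gdim_le] constrains nothing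
    else. *)
Lemma resolution_cons M K X (k : {linear K -> X}) (p : {linear X -> M})
    (Y : resolution K) : ses k p ->
  exists Z : resolution M, res_obj Z = fun i => if i is j.+1 then Y j else X.
Proof.
move=> kp; have [ki kx po] := kp.
pose Z i := if i is j.+1 then Y j else X.
pose d i : {linear Z i.+1 -> Z i} :=
  match i with 0%N => k \o res_aug Y | j.+1 => res_d Y j end.
have ex0 : exact_at (d 0%N) p.
  move=> y; split=> [/kx[z <-]|[x <-]]; last exact: (ses_comp0 _ kp).
  by have [x <-] := res_aug_onto Y z; exists x.
have exS i : exact_at (d i.+1) (d i).
  case: i => [|i]; last exact: res_exactS.
  move=> y; rewrite -(@res_exact0 _ _ Y); split=> [/ki//|y0].
  by rewrite /= y0 linear0.
by exists (Resolution po ex0 exS).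
Qed.

Lemma resolution_rV0 : exists Z : resolution 'rV[R]_0, forall i, zero_module (Z i).
Proof.
have ex (y : 'rV[R]_0) : (\0 : {linear 'rV[R]_0 -> 'rV[R]_0}) y = 0 <->
    exists x, (\0 : {linear 'rV[R]_0 -> 'rV[R]_0}) x = y.
  by split=> // _; exists 0; rewrite [RHS]rV0_eq0.
have ao : onto (\0 : {linear 'rV[R]_0 -> 'rV[R]_0}).
  by move=> y; exists 0; rewrite [RHS]rV0_eq0.
exists (@Resolution R _ (fun=> 'rV[R]_0) (fun=> \0) \0 ao ex (fun=> ex)) => i.
exact: rV0_eq0.
Qed.

Lemma has_gdim_leP n M : has_gdim_le C M n <-> gdim_le C n M.
Proof.
split.
  elim: n M => [|n IH] M [X [reX X0]].
    rewrite -(gdim_le_iso 0 (f := res_aug X)); first exact: reX.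
    apply: bijective_of => [y /res_exact0[x <-]|]; last exact: res_aug_onto.
    by rewrite (X0 1%N isT x) linear0.
  have ks := ses_ker (res_aug_onto X).
  apply/(gdim_le_syzygy n ks (reX 0%N isT)); apply: IH.
  have [x|a aE] := factor_inj (f := res_d X 0) (@ker_incl_inj _ _ _ (res_aug X)).
    by apply/ker_inclP/res_exact0; exists x.
  have inj_i := @ker_incl_inj _ _ _ (res_aug X).
  have ao : onto a.
    move=> y; have /res_exact0[x xE] := ker_val0 y.
    by exists x; apply: (injI inj_i); rewrite aE xE.
  have ex0 : exact_at (res_d X 1) a.
    move=> y; rewrite -(@res_exactS _ _ X 0) -aE.
    by split=> [->|/inj_i//]; rewrite linear0.
  exists (Resolution ao ex0 (fun i => @res_exactS _ _ X i.+1)).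
  by split=> i ni; [apply: reX|apply: X0].
elim: n M => [|n IH] M.
  move=> reM; have [Y Y0] := resolution_rV0.
  have [Z ZE] := resolution_cons Y (ses_row0 M).
  by exists Z; rewrite ZE; split=> -[|i].
move=> [K [X [k [p [kp reX /IH[Y [reY Y0]]]]]]].
have [Z ZE] := resolution_cons Y kp.
by exists Z; rewrite ZE; split=> -[|i] // ni; [apply: reY|apply: Y0].
Qed.

Lemma has_gdim_le_leq M m n :
  (m <= n)%N -> has_gdim_le C M m -> has_gdim_le C M n.
Proof.
move=> mn [X [reX X0]]; exists X; split=> i ni; last first.
  by apply: X0; apply: leq_ltn_trans ni.
by case: (leqP i m) => im; [apply: reX|apply/totally_reflexive_zero/X0].
Qed.
End GorensteinDimension.

Lemma inf_nat_fin (A : set nat) n :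
  inf_nat A = n%:E%E -> A n /\ forall m, A m -> (n <= m)%N.
Proof.
rewrite /inf_nat; case: pselect => // exA [].
case: ex_minnP => m /asboolP Am m_min <-; split=> // k Ak.
by apply: m_min; apply/asboolP.
Qed.

(** The equivalence says nothing about members of B below k, hence the second hypothesis. The
    infinite case is included. *)
Lemma inf_nat_shift (A B : set nat) k :
  (forall d, A d <-> B (d + k)%N) -> (forall m, B m -> (k <= m)%N) ->
  inf_nat B = (inf_nat A + k%:E)%E.
Proof.
move=> AB Bk; rewrite /inf_nat; case: pselect => exB; case: pselect => exA.
- case: ex_minnP => b /asboolP Bb b_min; case: ex_minnP => a /asboolP Aa a_min.
  suff -> : b = (a + k)%N by [].
  apply/eqP; rewrite eqn_leq.
  rewrite b_min; last by apply/asboolP; apply/AB.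
  have bE := subnK (Bk _ Bb); rewrite -[X in (_ <= X)%N]bE leq_add2r a_min //.
  by apply/asboolP/AB; rewrite bE.
- case: exA; case: exB => b /asboolP Bb; exists (b - k)%N; apply/asboolP/AB.
  by rewrite subnK // Bk.
- case: exB; case: exA => a /asboolP/AB Ba; exists (a + k)%N; exact/asboolP.
- by [].
Qed.

(** * The transpose compared with Ext *)

Section Transpose.
Variables (R : comNzRingType) (C : lmodType R).
Hypotheses (noethR : noetherian R) (semiC : semidualizing C).
Implicit Types A B K L M N P T U V W X Y E : lmodType R.

Local Notation reflexive := (totally_reflexive C).

Lemma presentation_syzygy M P1 P0 (f : {linear P1 -> P0}) (p : {linear P0 -> M}) :
  exact_at f p ->
  exists g : {linear P1 -> ker_mod p}, onto g /\ forall x, ker_incl p (g x) = f x.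
Proof.
move=> fp; have [x|g gE] := factor_inj (f := f) (@ker_incl_inj _ _ _ p).
  by apply/ker_inclP/fp; exists x.
exists g; split=> // y; have /fp[x xE] := ker_val0 y.
by exists x; apply: (injI (@ker_incl_inj _ _ _ p)); rewrite gE.
Qed.

(* Dualizing 0 -> M^C -> P0^C -> P1^C -> Tr -> 0 gives P1 -> P0 -> M^CC -> 0. *)
Lemma reflexive_of_transpose M P1 P0 (f : {linear P1 -> P0}) (p : {linear P0 -> M}) :
  projective_presentation f p -> reflexive (auslander_transpose C f) -> reflexive M.
Proof.
move=> [[fin1 pr1] [fin0 pr0] fp po] reT.
have re1 := totally_reflexive_proj semiC fin1 pr1.
have re0 := totally_reflexive_proj semiC fin0 pr0.
have reh1 := totally_reflexive_hom noethR semiC re1.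
have reh0 := totally_reflexive_hom noethR semiC re0.
have [t [to tx]] := cokerP (precomp f C).
have [e [eo eE]] := presentation_syzygy tx.
have ts := ses_ker to; have es := ses_ker eo.
have reI := totally_reflexive_ses_l noethR ts reh1 reT.
have reN := totally_reflexive_ses_l noethR es reh0 reI.
have /totally_reflexiveP[_ _ extI _] := reI.
have /totally_reflexiveP[_ _ extT _] := reT.
have /totally_reflexiveP[_ b1 _ _] := re1.
have /totally_reflexiveP[_ b0 _ _] := re0.
have [di dx do_] := ses_dual1 es (extI 0%N).
have [_ _ ti] := ses_dual1 ts (extT 0%N).
(* [ker_mod e] is M^C realised inside P0^C. [psi] maps P0 onto the dual of it with the same kernel
   as [p], so M is isomorphic to the dual of a totally reflexive module. *)
pose psi := precomp (ker_incl e) C \o biduality C P0.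
have [|y|F bF] := same_ker_iso po (b := psi).
- by move=> y; have [z <-] := do_ y; have [x <-] := bijective_onto b0 z; exists x.
- have -> : p y = 0 <-> psi y = 0.
    rewrite (fp y) (dx (biduality C P0 y)); split=> [[x <-]|[w wE]].
      exists (precomp (ker_incl t) C (biduality C P1 x)).
      apply: linear_ext => g.
      by rewrite -[LHS]/((ker_incl t (e g) : {linear _ -> _}) x) eE.
    have [z zE] := ti w; have [x xE] := bijective_onto b1 z.
    exists x; apply: (injI (bijective_inj b0)); rewrite -wE -zE -xE.
    apply: linear_ext => g.
    by rewrite -[RHS]/((ker_incl t (e g) : {linear _ -> _}) x) eE.
  by [].
apply/(gdim_le_iso noethR semiC 0 bF).
exact: totally_reflexive_hom.
Qed.

(* M has the given finite presentation; M' has the canonical free resolution that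
   computes Ext. *)
Lemma transpose_gdim k M M' P1 P0 (f : {linear P1 -> P0}) (p : {linear P0 -> M}) :
  stable_eq M M' -> projective_presentation f p -> gdim_le C k.+1 M ->
  (forall i, (i < k)%N -> extS_zero C i M') ->
  forall d, gdim_le C d (auslander_transpose C f) <->
    gdim_le C (d + k)
      (coker (precomp (ker_incl (free_cover (iter k (@syzygy R) M'))) C)).
Proof.
elim: k M M' P1 P0 f p => [|k IH] M M' P1 P0 f p MM' pres gM ext d.
  have [[fin1 pr1] [fin0 pr0] fp po] := pres.
  have re1 := totally_reflexive_proj semiC fin1 pr1.
  have re0 := totally_reflexive_proj semiC fin0 pr0.
  have [g [go gE]] := presentation_syzygy fp.
  have ps := ses_ker po; have gs := ses_ker go.
  have /(gdim_le_syzygy noethR semiC 0 ps re0) reK := gM.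
  have reL := totally_reflexive_ses_l noethR gs re1 reK.
  have reL' := totally_reflexive_hom noethR semiC reL.
  have /totally_reflexiveP[_ _ extK _] := reK.
  have [gi gx gl] := ses_dual1 gs (extK 0%N).
  have prF := @free_on_projective _ M'.
  have [F bF] := ext1_stable C pr0 prF ps (ses_free M') MM'.
  rewrite addn0 -(gdim_le_iso noethR semiC d bF).
  have [a [ao ax]] := cokerP (precomp (ker_incl p) C).
  have [t [to tx]] := cokerP (precomp f C).
  have fE (h : {linear P0 -> C}) :
      precomp g C (precomp (ker_incl p) C h) = precomp f C h.
    by apply: linear_ext => x; rewrite -[RHS]/(h (f x)) -gE.
  have gt h : precomp (ker_incl g) C (precomp g C h) = 0.
    by apply/gx; exists h.
  (* [u] embeds Ext^1(M, C), the cokernel of P0^C -> K^C, into the transpose; [v] has image L^C,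
     where L is the second syzygy. *)
  have [|u uE] := factor_onto ao (f := t \o precomp g C).
    by move=> m /ax[h <-]; apply/tx; exists h; rewrite -fE.
  have [|v vE] := factor_onto to (f := precomp (ker_incl g) C).
    by move=> m /tx[h <-]; rewrite -fE gt.
  symmetry; apply: (gdim_le_ses noethR semiC d (i := u) (q := v)) reL'.
  split=> [y|y|y].
  - have [m <-] := ao y; rewrite uE => /tx[h]; rewrite -fE => /(injI gi) hE.
    by apply/ax; exists h.
  - have [m <-] := to y; rewrite vE (gx m); split=> [[h <-]|[z]].
      by exists (a h); rewrite uE.
    have [h <-] := ao z; rewrite uE => e.
    have /tx[h' h'E] : t (m - precomp g C h) = 0 by rewrite linearB -e subrr.
    exists (precomp (ker_incl p) C h' + h); rewrite linearD /= fE h'E.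
    exact: subrK.
  - by have [m <-] := gl y; exists (t m); rewrite vE.
have [[fin1 pr1] [fin0 pr0] fp po] := pres.
have re1 := totally_reflexive_proj semiC fin1 pr1.
have re0 := totally_reflexive_proj semiC fin0 pr0.
have [g [go gE]] := presentation_syzygy fp.
have ps := ses_ker po; have gs := ses_ker go.
have /(gdim_le_syzygy noethR semiC k.+1 ps re0) gK := gM.
have finL := noetherian_sub noethR fin1 (@ker_incl_inj _ _ _ g).
(* A free cover P2 of the second syzygy turns P1 -> K into a presentation [f2] of K, the first
   syzygy of M. *)
have [m [c co]] := row_cover finL.
pose f2 := ker_incl g \o c.
have f2g : exact_at f2 g.
  move=> y; split=> [/ker_inclP[l <-]|[x <-]]; last exact: ker_val0.
  by have [x <-] := co l; exists x.
have fin2 := finite_module_row R m; have pr2 := @projective_row R m.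
have pres2 : projective_presentation f2 g by [].
have re2 := totally_reflexive_hom noethR semiC (totally_reflexive_row semiC m).
have prF := @free_on_projective _ M'.
have KM' := stable_eq_syzygy pr0 prF ps (ses_free M') MM'.
have ext' i : (i < k)%N -> extS_zero C i (syzygy M').
  by move=> ik; rewrite /extS_zero -iterSr; apply: ext.
have [MM _] := stable_eq_retract MM'.
have extM : ext1_zero C M := ext1_zero_retract MM (ext 0%N isT).
(* The bound is [d.+1] because Tr M -> P2^C -> Tr K is short exact with reflexive middle term;
   injectivity on the left comes from Ext^1(M, C) = 0. *)
have IHd := IH _ _ _ _ _ _ KM' pres2 gK ext' d.+1.
rewrite iterSr addnS -addSn -IHd.
have [pi px pl] := ses_dual1 ps extM.
have [gi gx] := ses_dual C f2g go.
have [t [to tx]] := cokerP (precomp f C).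
have [t2 [t2o t2x]] := cokerP (precomp f2 C).
have fE (h : {linear P0 -> C}) :
      precomp g C (precomp (ker_incl p) C h) = precomp f C h.
  by apply: linear_ext => x; rewrite -[RHS]/(h (f x)) -gE.
have [|u uE] := factor_onto to (f := precomp f2 C).
  by move=> h /tx[h' <-]; apply/gx; exists (precomp (ker_incl p) C h').
symmetry; apply: (gdim_le_syzygy noethR semiC d (k := u) (p := t2)) re2.
split=> // [y|y].
- have [h <-] := to y; rewrite uE => /gx[h' <-]; apply/tx.
  by have [h0 <-] := pl h'; exists h0.
- rewrite (t2x y); split=> -[h].
    by move=> <-; exists (t h); rewrite uE.
  by have [h' <-] := to h; rewrite uE => <-; exists h'.
Qed.
End Transpose.

Theorem theorem3p8 (R : comNzRingType) (C M : lmodType R) (n : nat)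
    (P1 P0 : lmodType R) (f : {linear P1 -> P0}) (p : {linear P0 -> M}) :
  noetherian R -> semiperfect R -> semidualizing C ->
  reduced_gperfect C M -> gdim C M = (n%:E)%E ->
  projective_presentation f p ->
  (gdim C M + gdim C (auslander_transpose C f) = gdim C (Ext n M C) + 1%N%:E)%E.
Proof.
move=> noethR _ semiC [_ _ rgr] gdM pres.
have [gM _] := inf_nat_fin gdM; rewrite gdM in rgr *.
have [[n0 extn] n_min] := inf_nat_fin rgr.
(* The reduced grade is positive, so n is written [k.+1] and the shift n - 1 is [k]. *)
case: n n0 => // k _ in gM extn n_min rgr gdM *.
have {}gM : gdim_le C k.+1 M by apply/(has_gdim_leP noethR semiC).
have ext i : (i < k)%N -> extS_zero C i M.
  move=> ik; apply/Ext_zero; case: (pselect (zero_module (Ext i.+1 M C))) => // nz.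
  by have := n_min i.+1 (conj isT nz); rewrite leqNgt ltnS ik.
have nre : ~ totally_reflexive C (auslander_transpose C f).
  move=> /(reflexive_of_transpose noethR semiC pres)/totally_reflexiveP[_ _ extM _].
  by apply: extn; apply/Ext_zero.
have [F bF] := Ext_coker C M k.
have TE d : has_gdim_le C (auslander_transpose C f) d <->
    has_gdim_le C (Ext k.+1 M C) (d + k).
  rewrite !(has_gdim_leP noethR semiC) (gdim_le_iso noethR semiC _ bF).
  exact: transpose_gdim (stable_eq_refl M) pres gM ext d.
have -> : gdim C (Ext k.+1 M C) = (gdim C (auslander_transpose C f) + k%:E)%E.
  (* A bound m < k for Ext would also give the bound k = 0 + k, that is, bound 0 for the transpose,
     contradicting [nre]. *)
  apply: inf_nat_shift => // m Em; rewrite leqNgt; apply/negP => mk; apply: nre.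
  apply/(has_gdim_leP noethR semiC 0)/TE.
  exact: has_gdim_le_leq (ltnW mk) Em.
(* Both infinite cases hold by computation, leaving an identity of natural numbers. *)
case: (gdim C _) => [r| |] //=.
have e : (k.+1 + r = r + k + 1)%N by rewrite addn1 addSn addnC.
exact (congr1 (@EFin nat) e).
Qed.
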